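(* Let $p=(p_1,\dots,p_n)$ be an $n$-dimensional probability distribution and let $O_p$ be a quantum probability oracle for $p$. There is a quantum algorithm that estimates the Shannon entropy $H(p)=-\sum_{i=1}^n p_i\log p_i$ within additive error $\epsilon$ using $\tilde{\mathcal{O}}\!\left(\frac{\sqrt{n}}{\epsilon}\right)$ queries to $O_p$ and $O_p^\dagger$.
   Context: A quantum probability oracle for $p$ is a unitary $O_p$ such that $O_p\ket{0}=\sum_{i=1}^n\sqrt{p_i}\ket{i}\ket{\psi_i}$ for some orthonormal states $\ket{\psi_1},\dots,\ket{\psi_n}$. A query means an application of $O_p$ or $O_p^\dagger$ (controlled versions allowed); other gates are free. $\tilde{\mathcal{O}}$ hides factors polylogarithmic in $n$ and $1/\epsilon$. *)

(* Defs.v *)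
From mathcomp Require Import all_boot all_algebra.
From mathcomp Require Import reals exp.
From mathcomp Require Import complex mxtens.

Set Implicit Arguments.
Unset Strict Implicit.
Unset Printing Implicit Defensive.

Import GRing.Theory Num.Theory.
Local Open Scope ring_scope.

Section QuantumQueryModel.
Variable R : realType.
Local Notation C := (R[i]).

Definition adjmx {a b : nat} (A : 'M[C]_(a, b)) : 'M[C]_(b, a) :=
  (map_mx (@conjc R) A)^T.

Definition unitary {d : nat} (U : 'M[C]_d) : Prop :=
  U *m adjmx U = 1%:M /\ adjmx U *m U = 1%:M.

Definition ket0 {d : nat} : 'cV[C]_d := \col_(i < d) ((nat_of_ord i == 0%N)%:R).

Definition ket {d : nat} (i : 'I_d) : 'cV[C]_d := delta_mx i 0.

Definition prob_dist {n : nat} (p : 'I_n -> R) : Prop :=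
  (forall i, 0 <= p i) /\ \sum_(i < n) p i = 1.

(* Shannon entropy (natural logarithm; 0 log 0 = 0 since ln 0 = 0 here
   and anyway 0 * _ = 0) *)
Definition shannon_entropy {n : nat} (p : 'I_n -> R) : R :=
  - \sum_(i < n) p i * ln (p i).

(* O is a quantum probability oracle for p, acting on C^n (x) C^m, where
   C^m is the "garbage" register:
   O |0>|0> = sum_i sqrt(p_i) |i>|psi_i> with psi_i orthonormal. *)
Definition prob_oracle {n m : nat} (p : 'I_n -> R) (O : 'M[C]_(n * m)) : Prop :=
  unitary O /\
  exists psi : 'I_n -> 'cV[C]_m,
    (forall i j, adjmx (psi i) *m psi j = ((i == j)%:R)%:M) /\
    O *m ket0 = \sum_(i < n) ((Num.sqrt (p i))%:C)%C *: (ket i *t psi i).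

(* A query: O, O^dagger, or their controlled versions (control qubit is the
   second tensor factor C^2), all tensored with the identity on the
   workspace C^w. The full space is ((C^n (x) C^m) (x) C^2) (x) C^w. *)
Inductive query_kind := QO | QOadj | QcO | QcOadj.

Definition query_op {n m w : nat} (O : 'M[C]_(n * m)) (k : query_kind)
  : 'M[C]_(n * m * 2 * w) :=
  let P0 : 'M[C]_2 := delta_mx 0 0 in
  let P1 : 'M[C]_2 := delta_mx 1 1 in
  match k with
  | QO => (O *t (1%:M : 'M[C]_2)) *t (1%:M : 'M[C]_w)
  | QOadj => (adjmx O *t (1%:M : 'M[C]_2)) *t (1%:M : 'M[C]_w)
  | QcO => ((1%:M *t P0) + (O *t P1)) *t (1%:M : 'M[C]_w)
  | QcOadj => ((1%:M *t P0) + (adjmx O *t P1)) *t (1%:M : 'M[C]_w)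
  end.

(* A query algorithm: initial (free) unitary U0, then a list of steps
   (query k, followed by a free unitary U). The number of queries is the
   length of the list. Free gates are arbitrary unitaries. *)
Definition final_state {n m w : nat} (O : 'M[C]_(n * m))
  (U0 : 'M[C]_(n * m * 2 * w)) (steps : seq (query_kind * 'M[C]_(n * m * 2 * w)))
  : 'cV[C]_(n * m * 2 * w) :=
  foldl (fun st kU => kU.2 *m (query_op O kU.1 *m st)) (U0 *m ket0) steps.

Definition sqmod (z : C) : R := let: Complex a b := z in a ^+ 2 + b ^+ 2.

(* Probability that measuring the final state in the computational basis
   yields an outcome j whose associated estimate f j is eps-close to x. *)
Definition success_prob {d : nat} (st : 'cV[C]_d) (f : 'I_d -> R) (x eps : R) : R :=
  \sum_(j < d | `|f j - x| <= eps) sqmod (st j 0).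

End QuantumQueryModel.

(* Main.v *)
(* Entropy is the series H(p) = sum_(k >= 1) (1/k) sum_a p_a (1 - p_a)^k, cut at
   k < 2^J ~ n/eps and split into dyadic blocks k in [k0, 2 k0).  For each block
   we build a circuit whose success probability is the normalised block, and
   estimate that probability.

   With u = O|0> and G_a = (2|u><u| - 1)(1 - 2 Pi_a), where Pi_a projects on the
   label a, one has G^2 u = 2 (1 - 2 p_a) G u - u; hence ((1 + G_a)/2)^k u has
   squared norm exactly (1 - p_a)^k.  Expanding the power gives a linear
   combination of the G_a^l u with binomial weights, and since the binomial law
   is concentrated, up to a polynomially small error only O(sqrt k log)
   consecutive values of l matter: this is the cost of the inner circuit.

   A block has probability q <= n/k0 because p (1 - p)^k <= 1/(k + 1).  Amplitude
   estimation applies the Grover iterate W of the inner circuit in superposition,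
   sum_k c_k |k> W^k v, and measures |k> in an eigenbasis of half the adjacency
   matrix A of a path.  As W^(k+1) v + W^(k-1) v = 2 (1 - 2 q) W^k v, this state
   is nearly an eigenvector of A/2 for 1 - 2 q, and the variance of the
   measured eigenvalue is governed by the first two finite differences of c.
   The precision e then costs sqrt(q)/e + 1/sqrt(e) iterations, so each block
   costs sqrt(n/k0)/eps * sqrt(k0) = sqrt(n)/eps up to logarithms. *)
Require Import Defs.
From mathcomp Require Import all_boot all_order all_algebra perm.
From mathcomp Require Import boolp classical_sets functions set_interval.
From mathcomp Require Import reals topology normedtype derive realfun exp.
From mathcomp Require Import complex mxtens spectral sesquilinear.
From mathcomp Require Import ring lra zify.

Set Implicit Arguments.
Unset Strict Implicit.
Unset Printing Implicit Defensive.

Import Order.TTheory GRing.Theory Num.Theory.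
Import numFieldNormedType.Exports.
Local Open Scope ring_scope.

(** * Vectors and unitary operators on finite index types *)

Section Vectors.
Variable R : realType.
Local Notation C := (R[i]).
Local Notation vec T := (T -> C).

(** No angle appears anywhere. Amplitude estimation is usually analysed through the phase of the
    Grover iterate; here the inner powers and the outer measurement both rest on the three-term
    recurrence alone, and the number read off is the cosine [1 - 2 q] itself. Free gates being
    arbitrary unitaries, the measuring basis may come from the spectral theorem without being
    computed.

    A separate oracle call stores a sample in a second register, and [Pi_a] becomes a comparison of
    two labels; the weight [p_a] in the sum is the probability of that sample.

    Dyadic blocks are forced by the balance of costs: one circuit for the whole series would always
    pay for the longest powers, while its success probability need not be small.

    All blocks must succeed together. Instead of taking medians, Chebyshev's inequality is pushed to
    failure [1/(3 J)] per block, and a union bound leaves [1/3]; this costs only a logarithmic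
    factor. *)

Definition dot (T : finType) (u v : vec T) : C := \sum_t conjc (u t) * v t.
Definition nrm2 (T : finType) (u : vec T) : R := \sum_t sqmod (u t).
Definition delta (T : finType) (s : T) : vec T := fun t => (t == s)%:R.

Lemma sqmodE (z : C) : (sqmod z)%:C%C = conjc z * z.
Proof.
case: z => a b; apply/eqP; rewrite eq_complex /= -!expr2; apply/andP; split; apply/eqP; ring.
Qed.

Lemma sqmod_ge0 (z : C) : 0 <= sqmod z.
Proof. by case: z => a b /=; rewrite addr_ge0 // sqr_ge0. Qed.

Lemma sqmodM (y z : C) : sqmod (y * z) = sqmod y * sqmod z.
Proof. case: y => a b; case: z => c d /=; ring. Qed.

Lemma sqmodR (a : R) : sqmod (a%:C%C) = a ^+ 2.
Proof. by rewrite /= expr0n addr0. Qed.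

Lemma sqmodN (z : C) : sqmod (- z) = sqmod z.
Proof. by case: z => a b /=; rewrite !sqrrN. Qed.

Lemma sqmodD_le (y z : C) : sqmod (y + z) <= 2 * sqmod y + 2 * sqmod z.
Proof. case: y => a b; case: z => c d /=.
have := sqr_ge0 (a - c); have := sqr_ge0 (b - d); nra.
Qed.

Variable T : finType.
Implicit Types u v w : vec T.

Lemma nrm2E u : (nrm2 u)%:C%C = dot u u.
Proof. by rewrite /nrm2 rmorph_sum; apply: eq_bigr => t _; rewrite /= sqmodE. Qed.

Lemma nrm2_ge0 u : 0 <= nrm2 u.
Proof. by apply: sumr_ge0 => t _; apply: sqmod_ge0. Qed.

Lemma dotC u v : conjc (dot u v) = dot v u.
Proof.
rewrite /dot rmorph_sum; apply: eq_bigr => t _.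
by rewrite rmorphM /= conjcK mulrC.
Qed.

Lemma dotDr u v w a b :
  dot u (fun t => a * v t + b * w t) = a * dot u v + b * dot u w.
Proof.
rewrite /dot !mulr_sumr -big_split /=; apply: eq_bigr => t _; ring.
Qed.

Lemma dotDl u v w a b :
  dot (fun t => a * v t + b * w t) u = conjc a * dot v u + conjc b * dot w u.
Proof. by rewrite -[LHS]conjcK dotC dotDr rmorphD !rmorphM /= !dotC. Qed.

Lemma dotsumr (I : finType) u (a : I -> C) (f : I -> vec T) :
  dot u (fun t => \sum_i a i * f i t) = \sum_i a i * dot u (f i).
Proof.
rewrite /dot; under eq_bigr do rewrite mulr_sumr.
rewrite exchange_big; apply: eq_bigr => i _ /=.
rewrite mulr_sumr; apply: eq_bigr => t _; ring.
Qed.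

Lemma dot_delta u t : dot (delta t) u = u t.
Proof.
rewrite /dot (bigD1 t) //= big1 ?addr0 /delta ?eqxx ?rmorph1 ?mul1r //.
by move=> s /negbTE ->; rewrite rmorph0 mul0r.
Qed.

(** Unitarity on bare functions, with the adjoint carried along as the inverse. Linearity follows,
    since each coordinate of [A u] is an inner product with a fixed vector ([uopE]). *)
Definition uop (A B : vec T -> vec T) : Prop :=
  [/\ forall u v, dot (A u) v = dot u (B v), cancel A B & cancel B A].

Lemma uopV A B : uop A B -> uop B A.
Proof. by case=> h c1 c2; split=> // u v; rewrite -dotC -h dotC. Qed.

Lemma uop_id : uop id id.
Proof. by split. Qed.

Lemma uop_comp A B A' B' : uop A B -> uop A' B' ->
  uop (fun v => A' (A v)) (fun v => B (B' v)).
Proof.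
case=> h1 h2 h3 [k1 k2 k3]; split=> [u v|u|u]; first by rewrite k1 h1.
  by rewrite k2 h2.
by rewrite h3 k3.
Qed.

Section Uop.
Variables A B : vec T -> vec T.
Hypothesis AB : uop A B.

Lemma uopE u t : A u t = dot (B (delta t)) u.
Proof. by case: (uopV AB) => h _ _; rewrite h dot_delta. Qed.

Lemma uop_lin u v a b :
  A (fun t => a * u t + b * v t) = fun t => a * A u t + b * A v t.
Proof. by apply: funext => t; rewrite uopE dotDr -!uopE. Qed.

Lemma uop_sum (I : finType) (a : I -> C) (f : I -> vec T) :
  A (fun t => \sum_i a i * f i t) = fun t => \sum_i a i * A (f i) t.
Proof.
apply: funext => t; rewrite uopE dotsumr.
by apply: eq_bigr => i _; rewrite uopE.
Qed.

Lemma uop_dot u v : dot (A u) (A v) = dot u v.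
Proof. by case: AB => h c _; rewrite h c. Qed.

Lemma uop_nrm2 u : nrm2 (A u) = nrm2 u.
Proof. by apply: (@complexI R); rewrite !nrm2E uop_dot. Qed.

End Uop.

Lemma uop_iter A B k : uop A B -> uop (iter k A) (iter k B).
Proof.
move=> AB; elim: k => [|k IH]; first exact: uop_id.
have [h c1 c2] := IH; have [k1 k2 k3] := AB.
split=> [u v|u|u].
- by rewrite iterSr h k1 -iterS.
- by rewrite iterSr iterS k2 c1.
- by rewrite iterS iterSr c2 k3.
Qed.

Lemma uop_iter_nrm2 A B k u : uop A B -> nrm2 (iter k A u) = nrm2 u.
Proof. by move=> AB; apply: uop_nrm2 (uop_iter k AB) _. Qed.

Lemma nrm2_comb u v (a b : R) :
  nrm2 (fun t => a%:C%C * u t + b%:C%C * v t)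
  = a ^+ 2 * nrm2 u + b ^+ 2 * nrm2 v + 2 * a * b * complex.Re (dot u v).
Proof.
rewrite /nrm2 /dot (raddf_sum (@complex.Re R)) !mulr_sumr -!big_split /=.
apply: eq_bigr => t _; case: (u t) => p q; case: (v t) => r s /=; ring.
Qed.

Lemma delta_nrm2 (t : T) : nrm2 (delta t) = 1.
Proof. by apply: (@complexI R); rewrite nrm2E dot_delta /delta eqxx. Qed.

Definition refl u v : vec T := fun t => 2 * dot u v * u t - v t.

Lemma uop_refl u : nrm2 u = 1 -> uop (refl u) (refl u).
Proof.
move=> nu; have uu : dot u u = 1 by rewrite -nrm2E nu.
have reflE w : refl u w = fun t => (2 * dot u w) * u t + (-1) * w t.
  by apply: funext => t; rewrite /refl mulN1r.
have cc w : refl u (refl u w) = w.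
  apply: funext => t; rewrite {1}/refl [in dot _ _]reflE dotDr uu /refl; ring.
split=> // v w; have c1 : conjc (-1 : C) = -1 by rewrite rmorphN rmorph1.
have cM (y z : C) : conjc (y * z) = conjc y * conjc z by exact: rmorphM.
rewrite !reflE dotDl dotDr cM dotC conjc_nat c1; ring.
Qed.

End Vectors.

(** * Free gates and Grover iterates *)

Section FreeGates.
Variable R : realType.
Local Notation C := (R[i]).
Local Notation vec T := (T -> C).

Section Block.
Variables (X' X S : finType) (f : X' -> X * S) (g : X * S -> X').
Hypotheses (fK : cancel f g) (gK : cancel g f).

Definition slice (s : S) (v : vec X') : vec X := fun x => v (g (x, s)).

(** A gate on [X] controlled by the register [S]. The bijection [f], [g] stands for a rearrangement
    of tensor factors, so Kronecker products appear only at the final compilation. *)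
Definition block (A : S -> vec X -> vec X) (v : vec X') : vec X' :=
  fun x => A (f x).2 (slice (f x).2 v) (f x).1.

Lemma slice_block A s v : slice s (block A v) = A s (slice s v).
Proof. by apply: funext => x; rewrite /slice /block gK. Qed.

Lemma slice_inj u v : (forall s, slice s u = slice s v) -> u = v.
Proof.
move=> h; apply: funext => x; have := congr1 (fun w => w (f x).1) (h (f x).2).
by rewrite /slice -surjective_pairing fK.
Qed.

Lemma sum_slice (V : nmodType) (h : X' -> V) :
  \sum_x h x = \sum_s \sum_x h (g (x, s)).
Proof.
rewrite exchange_big pair_big (reindex g) /=; last by exists f => x _.
by apply: eq_bigr => -[x s] _.
Qed.

Lemma dot_slice u v : dot u v = \sum_s dot (slice s u) (slice s v).
Proof. exact: sum_slice. Qed.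

Lemma nrm2_slice (u : vec X') : nrm2 u = \sum_s nrm2 (slice s u).
Proof. exact: sum_slice. Qed.

Lemma uop_block A B : (forall s, uop (A s) (B s)) -> uop (block A) (block B).
Proof.
move=> AB; split=> [u v|u|u].
- rewrite !dot_slice; apply: eq_bigr => s _; rewrite !slice_block.
  by case: (AB s) => ->.
- by apply: slice_inj => s; rewrite !slice_block; case: (AB s) => _ ->.
- by apply: slice_inj => s; rewrite !slice_block; case: (AB s) => _ _ ->.
Qed.

End Block.

Variable T : finType.

Definition sgnop (b : pred T) (v : vec T) : vec T :=
  fun t => if b t then - v t else v t.

Lemma uop_sgnop b : uop (sgnop b) (sgnop b).
Proof.
have cc v : sgnop b (sgnop b v) = v.
  by apply: funext => t; rewrite /sgnop; case: (b t) => //; rewrite opprK.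
split=> // u v; apply: eq_bigr => t _; rewrite /sgnop.
by case: (b t) => //; rewrite rmorphN mulNr mulrN.
Qed.

Definition permop (s : T -> T) (v : vec T) : vec T := fun t => v (s t).

Lemma uop_permop s s' : cancel s s' -> cancel s' s ->
  uop (permop s) (permop s').
Proof.
move=> k k'; split=> [u v|u|u]; last 2 first.
- by apply: funext => t; rewrite /permop k'.
- by apply: funext => t; rewrite /permop k.
rewrite /dot (reindex s') /=; last by exists s => x _.
by apply: eq_bigr => t _; rewrite /permop k'.
Qed.

Definition nrefl (u v : vec T) : vec T := fun t => v t - 2 * dot u v * u t.

Lemma uop_nrefl u : nrm2 u = 1 -> uop (nrefl u) (nrefl u).
Proof.
move=> nu; have e v : nrefl u v = sgnop predT (refl u v).
  by apply: funext => t; rewrite /nrefl /sgnop /refl opprB.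
have [h c _] := uop_comp (uop_refl nu) (uop_sgnop predT).
have e' v : nrefl u v = refl u (sgnop predT v).
  apply: funext => t; rewrite /nrefl /sgnop /refl /=.
  have -> : dot u (fun t => - v t) = - dot u v.
    by rewrite /dot -sumrN; apply: eq_bigr => s _; rewrite mulrN.
  ring.
split=> [v w|v|v].
- by rewrite e e' h.
- by rewrite e' e c.
- by rewrite e' e c.
Qed.

(* Householder: the reflection in the hyperplane orthogonal to
   [delta t0 - c] exchanges the two unit vectors. *)
Lemma state_prep (t0 : T) (c : T -> R) : \sum_t c t ^+ 2 = 1 ->
  exists A B : vec T -> vec T,
    uop A B /\ A (delta R t0) = fun t => (c t)%:C%C.
Proof.
(* If [c t0 = 1], the vector [delta t0 - c] vanishes and cannot be normalised, but then [c] already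
   is [delta t0]. *)
move=> nc; have [c0|c0] := eqVneq (c t0) 1.
  exists id, id; split; first exact: uop_id.
  have z t : t != t0 -> c t = 0.
    move=> tt0; move: nc; rewrite (bigD1 t0) //= c0 expr1n => /eqP.
    rewrite -subr_eq0 addrAC subrr add0r => /eqP/psumr_eq0P h.
    have /eqP := h (fun s _ => sqr_ge0 (c s)) t tt0.
    by rewrite sqrf_eq0 => /eqP.
  apply: funext => t; rewrite /delta; case: eqVneq => [->|/z ->] /=.
    by rewrite c0.
  by [].
have c1 : c t0 < 1.
  rewrite lt_neqAle c0 /= real_leNgt ?num_real //; apply/negP => h.
  have := nc; rewrite (bigD1 t0) //= => e.
  have : 0 <= \sum_(i | i != t0) c i ^+ 2 by apply: sumr_ge0 => i _; apply: sqr_ge0.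
  nra.
(* [r] is the length of [delta t0 - c]. *)
pose r := Num.sqrt (2 - 2 * c t0).
have r2 : r ^+ 2 = 2 - 2 * c t0 by rewrite sqr_sqrtr; lra.
have r0 : r != 0 by apply/eqP => e; move: r2; rewrite e expr0n /=; lra.
pose d : vec T := fun t => (((t == t0)%:R - c t) / r)%:C%C.
have nd : nrm2 d = 1.
  rewrite /nrm2 (eq_bigr (fun t => ((t == t0)%:R - 2 * ((t == t0)%:R * c t)
     + c t ^+ 2) / r ^+ 2)); last first.
    move=> t _; rewrite /d sqmodR expr_div_n; congr (_ / _).
    by case: eqP => _ /=; ring.
  rewrite -mulr_suml big_split sumrB nc -mulr_sumr /=.
  rewrite (bigD1 t0) //= big1 ?eqxx; last by move=> t /negbTE ->.
  rewrite (bigD1 t0) //= big1 ?eqxx; last by move=> t /negbTE ->; rewrite mul0r.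
  by rewrite r2 (_ : true%:R = 1 :> R) //; field; apply/eqP; lra.
exists (nrefl d), (nrefl d); split; first exact: uop_nrefl.
apply: funext => t; rewrite /nrefl.
have -> : dot d (delta R t0) = ((1 - c t0) / r)%:C%C.
  rewrite -dotC dot_delta /d eqxx; exact: conjc_real.
have -> : delta R t0 t = ((t == t0)%:R)%:C%C by rewrite /delta; case: (t == t0).
have -> : 2 = (2 : R)%:C%C by rewrite rmorphMn rmorph1.
rewrite -!rmorphM -rmorphB /=; congr (_%:C)%C.
have -> : 2 * ((1 - c t0) / r) * (((t == t0)%:R - c t) / r)
  = (2 - 2 * c t0) / r ^+ 2 * ((t == t0)%:R - c t) by field.
rewrite r2 divff; last by apply/eqP; lra.
ring.
Qed.

End FreeGates.

Section Grover.
Variable R : realType.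
Local Notation C := (R[i]).
Variable T : finType.
Local Notation vec := (T -> C).
Variables (u : vec) (Bf : vec -> vec) (x : R).
Hypotheses (nu : nrm2 u = 1) (uB : uop Bf Bf) (ux : dot u (Bf u) = x%:C%C).

Definition grover (w : vec) : vec := refl u (Bf w).
Local Notation G := grover.

Lemma uop_grover : uop G (fun w => Bf (refl u w)).
Proof. exact: (uop_comp uB (uop_refl nu)). Qed.

Lemma grover1 : G u = fun t => (2 * x)%:C%C * u t + (-1) * Bf u t.
Proof. by apply: funext => t; rewrite /G /refl ux rmorphM rmorph_nat mulN1r. Qed.

Let uu : dot u u = 1. Proof. by rewrite -nrm2E nu. Qed.

(** On the plane spanned by [u] and [Bf u] the iterate has trace [2 x] and determinant 1; this is
    its characteristic equation. *)
Lemma grover2 : G (G u) = fun t => (2 * x)%:C%C * G u t + (-1) * u t.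
Proof.
rewrite {1}grover1 (uop_lin uop_grover); apply: funext => t.
have [_ BB _] := uB; congr (_ + _); rewrite /G BB /refl uu.
by congr (_ * _); ring.
Qed.

Lemma grover_iter k : iter k.+2 G u
  = fun t => (2 * x)%:C%C * iter k.+1 G u t + (-1) * iter k G u t.
Proof. by rewrite !iterSr grover2 (uop_lin (uop_iter k uop_grover)) -iterSr. Qed.

Let dGu : dot (G u) u = x%:C%C.
Proof.
have e : dot (Bf u) u = x%:C%C by rewrite -dotC ux; exact: conjc_real.
rewrite grover1 dotDl uu e (_ : conjc (-1 : C) = -1); last by rewrite rmorphN rmorph1.
rewrite (conjc_real (2 * x)) rmorphM rmorph_nat; ring.
Qed.

(** With [x] the cosine of the rotation angle, this is four times the squared sine. For
    [x = 1 - 2 q] it equals [16 q (1 - q)]: the source of the [sqrt q] gain at small [q]. *)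
Lemma grover_gap k :
  nrm2 (fun t => iter k.+2 G u t - iter k G u t) = 4 * (1 - x ^+ 2).
Proof.
have -> : (fun t => iter k.+2 G u t - iter k G u t)
  = iter k G (fun t => (2 * x)%:C%C * G u t + (-2)%:C%C * u t).
  rewrite (uop_lin (uop_iter k uop_grover)) grover_iter -iterSr.
  by apply: funext => t; rewrite rmorphN rmorph_nat; ring.
rewrite (uop_iter_nrm2 _ _ uop_grover) nrm2_comb nu (uop_nrm2 uop_grover) nu dGu /=.
ring.
Qed.

Definition ghalf (w : vec) : vec := fun t => (2^-1)%:C%C * w t + (2^-1)%:C%C * G w t.

(** Pairing the recurrence with [G w] gives [2 x] times the squared norm of [w]. Since [G] preserves
    inner products, the two terms on the left are conjugate, so the real part of [dot w (G w)] is
    [x] times that squared norm. *)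
Lemma ghalf_nrm2 w : (forall t, G (G w) t + w t = (2 * x)%:C%C * G w t) ->
  nrm2 (ghalf w) = (1 + x) / 2 * nrm2 w.
Proof.
move=> h; rewrite nrm2_comb (uop_nrm2 uop_grover).
have : dot (G w) (fun t => G (G w) t + w t) = (2 * x)%:C%C * (nrm2 w)%:C%C.
  rewrite (funext h) -[nrm2 w](uop_nrm2 uop_grover) nrm2E /dot mulr_sumr.
  by apply: eq_bigr => t _; ring.
have -> : (fun t => G (G w) t + w t) = (fun t => 1 * G (G w) t + 1 * w t).
  by apply: funext => t; rewrite !mul1r.
rewrite dotDr !mul1r (uop_dot uop_grover) -[dot (G w) w]dotC.
case: (dot w (G w)) => a b /= /eqP; rewrite eq_complex /= => /andP[/eqP e _].
have {}e : a + a = 2 * x * nrm2 w by rewrite e; ring.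
have -> : a = x * nrm2 w by lra.
lra.
Qed.

(** [ghalf] is a polynomial in [G], so the recurrence satisfied by [u] passes to every iterate; it
    is the condition under which [ghalf] scales the norm. *)
Lemma ghalf_iter_rec k t : let w := iter k ghalf u in
  G (G w) t + w t = (2 * x)%:C%C * G w t.
Proof.
elim: k t => [|k IH] t /=; first by rewrite grover2 /=; ring.
move: IH; set w := iter k ghalf u => IH.
rewrite /ghalf !(uop_lin uop_grover).
have -> : G (G (G w)) = fun t => (2 * x)%:C%C * G (G w) t + (-1) * G w t.
  rewrite -(uop_lin uop_grover); congr G; apply: funext => s.
  by have := IH s => <-; ring.
have := IH t => e.
have -> : G (G w) t = (2 * x)%:C%C * G w t - w t by rewrite -e; ring.
ring.
Qed.

Lemma ghalf_iter_nrm2 k : nrm2 (iter k ghalf u) = ((1 + x) / 2) ^+ k.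
Proof.
elim: k => [|k IH]; first by rewrite expr0.
rewrite iterS ghalf_nrm2 ?IH ?exprS // => t; exact: ghalf_iter_rec.
Qed.

Definition binw (k l : nat) : R := 'C(k, l)%:R / 2 ^+ k.

Lemma ghalf_iter_sum L k : (k < L)%N ->
  iter k ghalf u = fun t => \sum_(l < L) (binw k l)%:C%C * iter l G u t.
Proof.
elim: k => [|k IH] kL.
  apply: funext => t; case: L kL => // L _.
  rewrite big_ord_recl big1 ?addr0 /binw /= ?bin0 ?expr0 ?divr1 ?rmorph1 ?mul1r //.
  by move=> i _; rewrite bin0n /= mul0r rmorph0 mul0r.
rewrite iterS IH; last exact: ltnW.
rewrite /ghalf (uop_sum uop_grover); apply: funext => t.
case: L kL {IH} => // L kL; rewrite ltnS in kL.
rewrite [in X in _ * X + _]big_ord_recl [in X in _ + _ * X]big_ord_recr /=.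
have -> : binw k L = 0 by rewrite /binw bin_small // mul0r.
rewrite rmorph0 mul0r addr0.
rewrite [RHS]big_ord_recl /= mulrDr -addrA; congr (_ + _).
  rewrite mulrA -rmorphM; congr (_%:C%C * _); rewrite /binw !bin0 exprS /=.
  by field; rewrite expf_neq0 // pnatr_eq0.
rewrite !mulr_sumr -big_split /=; apply: eq_bigr => i _.
have -> : binw k.+1 (bump 0 i) = 2^-1 * binw k (bump 0 i) + 2^-1 * binw k i.
  rewrite /binw /bump /= add1n binS natrD exprS.
  by field; rewrite expf_neq0 // pnatr_eq0.
rewrite rmorphD !rmorphM /=; ring.
Qed.

End Grover.

(** * Binomial tails and the clipped linear combination *)

Section BinomialTail.
Variable R : realType.
Local Notation binw := (@binw R).

Lemma bernoulli_ineq (y : R) k : -1 <= y -> 1 + k%:R * y <= (1 + y) ^+ k.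
Proof.
move=> y1; elim: k => [|k IH]; first by rewrite expr0; lra.
rewrite exprS -natr1; have h : 0 <= 1 + y by lra.
have k0 : 0 <= k%:R :> R by [].
have := ler_wpM2l h IH; have := sqr_ge0 y; nra.
Qed.

Lemma binw_ge0 k l : 0 <= binw k l.
Proof. by rewrite divr_ge0 // exprn_ge0. Qed.

Lemma binw_gen L k (y : R) : (k < L)%N ->
  \sum_(l < L) binw k l * y ^+ l = ((1 + y) / 2) ^+ k.
Proof.
move=> kL; rewrite expr_div_n exprDn mulr_suml.
rewrite -(big_mkord xpredT (fun l => 1 ^+ (k - l) * y ^+ l *+ 'C(k, l) / 2 ^+ k)).
rewrite -(big_mkord xpredT (fun l => binw k l * y ^+ l)).
rewrite [LHS](big_cat_nat _ kL) //= [X in _ + X]big_nat_cond.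
rewrite [X in _ + X]big1 ?addr0; last first.
  by move=> i /andP[/andP[h _] _]; rewrite /binw bin_small ?mul0r.
by apply: eq_bigr => i _; rewrite /binw expr1n mul1r -[_ *+ _]mulr_natr; ring.
Qed.

Lemma binw_sum L k : (k < L)%N -> \sum_(l < L) binw k l = 1.
Proof.
move=> kL; have := binw_gen 1 kL.
rewrite (_ : (1 + 1) / 2 = 1 :> R); last by field.
by rewrite expr1n => <-; apply: eq_bigr => l _; rewrite expr1n mulr1.
Qed.

(* Chernoff bound with base [a = 1 + 1/M] in place of an exponential. *)
Lemma binw_tail L k M t : (k < L)%N -> (0 < M)%N -> (k <= M ^ 2)%N ->
  \sum_(l < L | (2 * l + 2 * (t * M) <= k)%N || (k + 2 * (t * M) <= 2 * l)%N)
     binw k l <= 4 / 4 ^+ t.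
Proof.
move=> kL M0 kM; set D := (t * M)%N; 
pose P (l : nat) := (2 * l + 2 * D <= k)%N || (k + 2 * D <= 2 * l)%N.
rewrite -[leLHS]/(\sum_(l < L | P l) binw k l).
pose a : R := 1 + M%:R^-1.
have M0' : 0 < M%:R :> R by rewrite ltr0n.
have a1 : 1 <= a by rewrite /a lerDl invr_ge0 ltW.
have a0 : 0 < a by lra.
have aM : 2 <= a ^+ M.
  have /(bernoulli_ineq M) : (-1 : R) <= M%:R^-1.
    by apply: le_trans (_ : 0 <= _); rewrite ?invr_ge0 ?ltW //; lra.
  by rewrite divff ?gt_eqF.
(* Since [(1 + a ^+ 2) / 2 = a + y <= a * (1 + y)], the generating sums exceed [a ^+ k] by at most
   the factor [(1 + y) ^+ k], which [k <= M ^ 2] keeps below 2. *)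
pose y : R := (2 * M%:R ^+ 2)^-1.
have y0 : 0 < y by rewrite invr_gt0 mulr_gt0 // exprn_gt0.
have M1 : 1 <= M%:R :> R by rewrite ler1n.
have yM : y * (2 * M%:R ^+ 2) = 1 by rewrite mulVf // gt_eqF // mulr_gt0 // exprn_gt0.
have y1 : y <= 2^-1.
  have : 1 <= M%:R ^+ 2 :> R by rewrite expr_ge1.
  nra.
have ky : k%:R * y <= 2^-1.
  have : k%:R <= M%:R ^+ 2 :> R by rewrite -natrX ler_nat.
  have : 0 <= k%:R :> R by [].
  nra.
have hA : (1 + a ^+ 2) / 2 <= a * (1 + y).
  have -> : a = 1 + 2 * M%:R * y.
    by rewrite /a /y; congr (1 + _); field; rewrite gt_eqF.
  have : 0 <= y * (2 * M%:R * y) by rewrite !mulr_ge0 // ltW.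
  nra.
have hB : (1 + y) ^+ k <= 2.
  have /(bernoulli_ineq k) h1 : -1 <= - y by lra.
  have h2 : (1 + y) ^+ k * (1 + - y) ^+ k <= 1.
    rewrite -exprMn; apply: exprn_ile1; nra.
  have h3 : 0 <= (1 + y) ^+ k by apply: exprn_ge0; lra.
  nra.
have S1 : \sum_(l < L) binw k l * a ^+ (2 * l) <= 2 * a ^+ k.
  under eq_bigr do rewrite exprM.
  rewrite binw_gen //; apply: le_trans (_ : (a * (1 + y)) ^+ k <= _).
    by apply: lerXn2r => //; rewrite nnegrE; have := sqr_ge0 a; nra.
  by rewrite exprMn mulrC; apply: ler_wpM2r => //; apply: exprn_ge0; lra.
have S2 : \sum_(l < L) binw k l * a ^+ (2 * (k - l)) <= 2 * a ^+ k.
  rewrite (eq_bigr (fun l : 'I_L => a ^+ (2 * k) * (binw k l * (a ^- 2) ^+ l))); last first.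
    move=> l _; have [lk|lk] := leqP l k; last by rewrite /binw bin_small // !mul0r mulr0.
    rewrite mulnBr exprB ?unitfE ?gt_eqF //; last by rewrite leq_mul2l lk.
    by rewrite -[a ^- 2]exprVn -exprM -exprVn; ring.
  rewrite -mulr_sumr binw_gen // exprM -exprMn.
  have -> : a ^+ 2 * ((1 + a ^- 2) / 2) = (1 + a ^+ 2) / 2.
    by field; rewrite gt_eqF.
  apply: le_trans (_ : (a * (1 + y)) ^+ k <= _).
    by apply: lerXn2r => //; rewrite nnegrE; have := sqr_ge0 a; nra.
  by rewrite exprMn mulrC; apply: ler_wpM2r => //; apply: exprn_ge0; lra.
(* Markov's inequality for both tails at once: at an index in either tail, one of the two
   exponentials reaches [a ^+ (k + 2 * D)]. *)
have S : (\sum_(l < L | P l) binw k l) * a ^+ (k + 2 * D) <= 4 * a ^+ k.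
  have -> : 4 * a ^+ k = 2 * a ^+ k + 2 * a ^+ k by ring.
  apply: le_trans (lerD S1 S2); rewrite -big_split mulr_suml /=.
  rewrite [leRHS](bigID (fun l : 'I_L => P l)) /= -[leLHS]addr0; apply: lerD; last first.
    by apply: sumr_ge0 => l _; rewrite -mulrDr mulr_ge0 ?binw_ge0 ?addr_ge0 ?exprn_ge0 // ltW.
  apply: ler_sum => l /orP h; rewrite -mulrDr.
  have [lk|lk] := leqP l k; last by rewrite /binw bin_small // !mul0r.
  apply: ler_wpM2l; first exact: binw_ge0.
  have p0 j : 0 <= a ^+ j by rewrite exprn_ge0 // ltW.
  case: h => h.
    apply: le_trans (_ : a ^+ (2 * (k - l)) <= _); last by rewrite lerDr.
    by rewrite ler_weXn2l //; clear -h; lia.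
  apply: le_trans (_ : a ^+ (2 * l) <= _); last by rewrite lerDl.
  by rewrite ler_weXn2l.
have D4 : 4 ^+ t <= a ^+ (2 * D).
  have -> : (2 * D = M * 2 * t)%N by rewrite /D mulnA mulnC mulnA.
  rewrite !exprM; apply: lerXn2r; rewrite ?nnegrE ?exprn_ge0 ?(ltW a0) //.
  rewrite expr2; move: (a ^+ M) aM => z z2; nra.
rewrite ler_pdivlMr ?exprn_gt0 //.
have s0 : 0 <= \sum_(l < L | P l) binw k l by apply: sumr_ge0 => l _; apply: binw_ge0.
apply: le_trans (ler_wpM2l s0 D4) _.
move: S; rewrite exprD [a ^+ k * _]mulrC mulrA.
by rewrite ler_pM2r // exprn_gt0.
Qed.

End BinomialTail.

Section Jensen.
Variable R : realType.
Local Notation C := (R[i]).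

Lemma jensen_sqr (I : finType) (b x : I -> R) : (forall i, 0 <= b i) ->
  \sum_i b i = 1 -> (\sum_i b i * x i) ^+ 2 <= \sum_i b i * x i ^+ 2.
Proof.
move=> b0 b1; set m := \sum_i b i * x i.
have : 0 <= \sum_i b i * (x i - m) ^+ 2.
  by apply: sumr_ge0 => i _; rewrite mulr_ge0 ?sqr_ge0.
rewrite (eq_bigr (fun i => b i * x i ^+ 2 - 2 * m * (b i * x i) + m ^+ 2 * b i)).
  by rewrite big_split sumrB -!mulr_sumr /= b1 -/m; lra.
by move=> i _; ring.
Qed.

Lemma jensen_nrm2 (I T : finType) (b : I -> R) (z : I -> T -> C) :
  (forall i, 0 <= b i) -> \sum_i b i = 1 ->
  nrm2 (fun t => \sum_i (b i)%:C%C * z i t) <= \sum_i b i * nrm2 (z i).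
Proof.
move=> b0 b1; rewrite /nrm2; under [leRHS]eq_bigr do rewrite mulr_sumr.
rewrite exchange_big; apply: ler_sum => t _ /=.
have -> : \sum_i (b i)%:C%C * z i t = Complex (\sum_i b i * complex.Re (z i t))
   (\sum_i b i * complex.Im (z i t)).
  apply/eqP; rewrite eq_complex /=; apply/andP; split; apply/eqP.
    rewrite (raddf_sum (@complex.Re R)); apply: eq_bigr => i _ /=.
    by case: (z i t) => ? ? /=; ring.
  rewrite (raddf_sum (@complex.Im R)); apply: eq_bigr => i _ /=.
  by case: (z i t) => ? ? /=; ring.
rewrite /=; apply: le_trans (lerD (jensen_sqr _ b0 b1) (jensen_sqr _ b0 b1)) _.
rewrite -big_split /=; apply: ler_sum => i _; rewrite -mulrDr.
by case: (z i t).
Qed.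

(** The cross term is split by the arithmetic-geometric mean inequality with a free parameter [eta],
    so squared norms are compared without taking roots. *)
Lemma nrm2D_approx (T : finType) (y d : T -> C) (eta : R) : 0 < eta ->
  `|nrm2 (fun t => y t + d t) - nrm2 y| <= eta * nrm2 y + (1 + eta^-1) * nrm2 d.
Proof.
move=> e0; set c : R := \sum_t (complex.Re (y t) * complex.Re (d t) + complex.Im (y t) * complex.Im (d t)).
have -> : nrm2 (fun t => y t + d t) - nrm2 y = 2 * c + nrm2 d.
  rewrite /nrm2 /c mulr_sumr -sumrB -big_split /=; apply: eq_bigr => t _.
  by case: (y t) => ? ?; case: (d t) => ? ? /=; ring.
have h (s : R) : s ^+ 2 = 1 -> 0 <= eta * nrm2 y + eta^-1 * nrm2 d + s * 2 * c.
  move=> s2; rewrite /nrm2 /c !mulr_sumr -!big_split /=; apply: sumr_ge0 => t _.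
  case: (y t) => p q; case: (d t) => p' q' /=.
  have -> : eta * (p ^+ 2 + q ^+ 2) + eta^-1 * (p' ^+ 2 + q' ^+ 2) + s * 2 * (p * p' + q * q')
    = eta * ((p + s * eta^-1 * p') ^+ 2 + (q + s * eta^-1 * q') ^+ 2)
      + (1 - s ^+ 2) * eta^-1 * (p' ^+ 2 + q' ^+ 2).
    by field; rewrite gt_eqF.
  by rewrite s2 subrr !mul0r addr0 mulr_ge0 ?addr_ge0 ?sqr_ge0 // ltW.
have h1 := h 1 (expr1n _ _); have h2 := h (-1) (sqrr_sign _ 1).
have n0 := nrm2_ge0 d.
have i0 : 0 <= eta^-1 * nrm2 d by rewrite mulr_ge0 // invr_ge0 ltW.
by rewrite ler_norml; apply/andP; split; lra.
Qed.

End Jensen.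

(* [clip k D l] is the exponent of [G] attached to [l] after shifting the window
   [|2 l - k| < 2 D] to start at [0]; indices outside the window get exponent [0]. *)
Definition clip (k D l : nat) : nat :=
  if ((k./2 - D <= l) && (l <= (k./2 - D) + (2 * D).+1))%N
  then (l - (k./2 - D))%N else 0%N.

Lemma clip_le k D l : (clip k D l <= (2 * D).+1)%N.
Proof. by rewrite /clip; case: ifP => // /andP[h1 h2]; lia. Qed.

Lemma clip_id k D l : ~~ ((2 * l + 2 * D <= k)%N || (k + 2 * D <= 2 * l)%N) ->
  ((k./2 - D) + clip k D l = l)%N.
Proof.
rewrite negb_or -!ltnNge => /andP[h1 h2]; rewrite /clip ifT; last lia.
by lia.
Qed.

Section ClippedLcu.
Variable R : realType.
Local Notation C := (R[i]).
Variable T : finType.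
Local Notation vec := (T -> C).
Variables (u : vec) (Bf : vec -> vec) (x : R).
Hypotheses (nu : nrm2 u = 1) (uB : uop Bf Bf) (ux : dot u (Bf u) = x%:C%C).
Hypotheses (x0 : 0 <= 1 + x) (x1 : x <= 1).
Local Notation G := (grover u Bf).

Definition lcu (L k D : nat) : vec :=
  fun t => \sum_(l < L) (binw R k l)%:C%C * iter (clip k D l) G u t.

(* After the shift by [G ^ (k/2 - D)], which preserves norms, the clipped sum
   only differs from [((1 + G) / 2) ^ k u] in the tail of the binomial. *)
Lemma lcu_approx L k M t (eta : R) : (k < L)%N -> (0 < M)%N ->
  (k <= M ^ 2)%N -> 0 < eta ->
  `|nrm2 (lcu L k (t * M)) - ((1 + x) / 2) ^+ k|
    <= eta + (1 + eta^-1) * (16 / 4 ^+ t).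
Proof.
move=> kL M0 kM e0; set D := (t * M)%N.
have ub := @uop_grover _ _ u Bf nu uB; set s := (k./2 - D)%N.
pose P (l : nat) := (2 * l + 2 * D <= k)%N || (k + 2 * D <= 2 * l)%N.
pose y := iter k (ghalf u Bf) u.
have ny : nrm2 y = ((1 + x) / 2) ^+ k by exact: ghalf_iter_nrm2.
pose dz (l : 'I_L) : vec :=
  fun r => iter (s + clip k D l) G u r - iter l G u r.
pose d : vec := fun r => \sum_(l < L) (binw R k l)%:C%C * dz l r.
have e : iter s G (lcu L k D) = fun r => y r + d r.
  rewrite /lcu (uop_sum (uop_iter s ub)) /y (ghalf_iter_sum nu uB kL).
  apply: funext => r; rewrite /d -big_split /=; apply: eq_bigr => l _.
  by rewrite -mulrDr /dz iterD addrC subrK.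
(* [16 = 4 * 4]: the difference of two unit vectors has squared norm at most 4, and the tail carries
   weight at most [4 / 4 ^+ t]. *)
have nd : nrm2 d <= 16 / 4 ^+ t.
  apply: le_trans (jensen_nrm2 _ _ _) _; rewrite ?binw_sum //.
    by move=> i; apply: binw_ge0.
  apply: le_trans (_ : 4 * \sum_(l < L | P l) binw R k l <= _); last first.
    have := binw_tail R t kL M0 kM; rewrite -/D -/(P _).
    by rewrite -[X in X <= _ -> _]/(\sum_(l < L | P l) binw R k l); lra.
  rewrite [leLHS](bigID (fun l : 'I_L => P l)) /= [X in _ + X]big1 ?addr0; last first.
    move=> l /clip_id h; rewrite /dz h.
    have -> : (fun r => iter l G u r - iter l G u r) = (fun r => 0).
      by apply: funext => r; rewrite subrr.
    by rewrite /nrm2 big1 ?mulr0 // => r _; rewrite /= expr0n addr0.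
  rewrite mulr_sumr; apply: ler_sum => l _; rewrite mulrC.
  apply: ler_wpM2r; first exact: binw_ge0.
  apply: le_trans (_ : \sum_r (2 * sqmod (iter (s + clip k D l) G u r)
     + 2 * sqmod (iter l G u r)) <= _).
    by apply: ler_sum => r _; rewrite -[sqmod (iter l G u r)]sqmodN; apply: sqmodD_le.
  rewrite big_split -!mulr_sumr /= -!/(nrm2 _) !(uop_iter_nrm2 _ _ ub) nu; lra.
rewrite -ny -[nrm2 (lcu _ _ _)](uop_iter_nrm2 s _ ub) e.
apply: le_trans (nrm2D_approx y d e0) _; rewrite ny; apply: lerD.
  rewrite -[leRHS]mulr1; apply: ler_wpM2l; first exact: ltW.
  apply: exprn_ile1; first by rewrite divr_ge0.
  by have := x1; lra.
by apply: ler_wpM2l nd; rewrite addr_ge0 // invr_ge0 ltW.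
Qed.

End ClippedLcu.

(** * Windows with small first and second differences *)

Section Window.
Variable R : realType.

Lemma window_exists N : (0 < N)%N -> exists c : nat -> R,
  [/\ [/\ c 0%N = 0, c 1%N = 0, c (4 * N).+1 = 0 & c (4 * N).+2 = 0],
      \sum_(k < (4 * N).+3) c k ^+ 2 = 1,
      \sum_(j < (4 * N).+1) (c j.+2 - c j.+1) ^+ 2 <= 32 / N%:R ^+ 2 &
      \sum_(j < (4 * N).+1) (c j.+2 - 2 * c j.+1 + c j) ^+ 2 <= 36 / N%:R ^+ 4].
Proof.
(* [c] is proportional to [((k - 1) (4 N + 1 - k)) ^ 2], which vanishes to second
   order at both ends, so that no boundary term spoils the second difference. *)
move=> N0; pose n : R := N%:R; have n1 : 1 <= n by rewrite /n ler1n.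
pose F (y : R) := (y * (4 * n - y)) ^+ 2.
pose a (k : nat) : R := if (0 < k <= (4 * N).+1)%N then F (k%:R - 1) else 0.
have a0 : a 0%N = 0 by [].
have a1 : a 1%N = 0 by rewrite /a /= /F subrr mul0r expr0n.
have aS (j : nat) : (j <= 4 * N)%N -> a j.+1 = F j%:R.
  by move=> h; rewrite /a ifT ?ltnS // -natr1 addrK.
have a2 : a (4 * N).+1 = 0 by rewrite aS // /F natrM subrr mulr0 expr0n.
have a3 : a (4 * N).+2 = 0 by rewrite /a ltnn.
have jr (j : nat) : (j <= 4 * N)%N -> 0 <= (j%:R : R) <= 4 * n.
  by move=> h; rewrite ler0n /= /n -natrM ler_nat.
have d1 (j : 'I_(4 * N).+1) : (a j.+2 - a j.+1) ^+ 2 <= (32 * n ^+ 3) ^+ 2.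
  rewrite -ler_sqrt ?exprn_even_ge0 // !sqrtr_sqr [leRHS]ger0_norm; last first.
    by rewrite mulr_ge0 // exprn_ge0 //; lra.
  have := ltn_ord j; rewrite ltnS leq_eqVlt => /orP[/eqP ->|jN].
    by rewrite a2 a3 subrr normr0 mulr_ge0 // exprn_ge0 //; lra.
  rewrite !aS // 1?ltnW // -natr1.
  have := jr j.+1 jN; rewrite -natr1; move: (jr _ (ltnW jN)).
  move: (j%:R) => y /andP[y0 y1] /andP[y2 y3].
  have -> : F (y + 1) - F y = (4 * n - 2 * y - 1) *
     ((y + 1) * (4 * n - (y + 1)) + y * (4 * n - y)) by rewrite /F; ring.
  have -> : 32 * n ^+ 3 = (4 * n) * (8 * n ^+ 2) by ring.
  rewrite normrM; apply: ler_pM => //; first by rewrite ler_norml; apply/andP; split; lra.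
  have g (z : R) : 0 <= z -> z <= 4 * n -> 0 <= z * (4 * n - z) <= 4 * n ^+ 2.
    move=> z0 z1; rewrite mulr_ge0 ?subr_ge0 //=.
    by have := sqr_ge0 (z - 2 * n); nra.
  have /andP[g1 g2] := g _ y0 y1; have /andP[g3 g4] := g _ y2 y3.
  by rewrite ger0_norm; lra.
have d2 (j : 'I_(4 * N).+1) : (a j.+2 - 2 * a j.+1 + a j) ^+ 2 <= (34 * n ^+ 2) ^+ 2.
  rewrite -ler_sqrt ?exprn_even_ge0 // !sqrtr_sqr [leRHS]ger0_norm; last first.
    by rewrite mulr_ge0 // exprn_ge0 //; lra.
  case: j => -[|j] /= jN.
    rewrite a0 a1 mulr0 subr0 addr0 aS; last lia.
    by rewrite /F mul1r ger0_norm ?sqr_ge0 //; nra.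
  rewrite ltnS leq_eqVlt in jN; case/orP: jN => [/eqP jE|jN].
    rewrite jE a2 a3 mulr0 subr0 add0r -jE aS; last lia.
    have -> : (j%:R : R) = 4 * n - 1 by rewrite /n -natrM -jE -natr1 addrK.
    by rewrite /F ger0_norm ?sqr_ge0 //; nra.
  rewrite !aS //; try lia.
  have := jr j.+2 jN; have := jr j (ltnW (ltnW jN)); have e1 : (j.+1%:R : R) = j%:R + 1 by rewrite natr1.
  have e2 : (j.+2%:R : R) = j%:R + 1 + 1 by rewrite !natr1.
  rewrite e1 e2.
  move: (j%:R) => y /andP[y0 y1] /andP[y2 y3].
  have -> : F (y + 1 + 1) - 2 * F (y + 1) + F y =
     12 * (y + 1) ^+ 2 - 48 * n * (y + 1) + 32 * n ^+ 2 + 2 by rewrite /F; ring.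
  have h1 : 0 <= (y + 1) * (4 * n - (y + 1)) by rewrite mulr_ge0 //; lra.
  have h2 := sqr_ge0 ((y + 1) - 2 * n).
  have h3 : 1 <= n ^+ 2 by rewrite expr_ge1.
  by rewrite ler_norml; apply/andP; split; nra.
pose A := \sum_(k < (4 * N).+3) a k ^+ 2.
(* The middle half of the window has [2 N] indices, each contributing at least [(3 n ^+ 2) ^+ 4].
   Dividing the sums of differences by this gives [1024 * 5 / 162 < 32] and
   [1156 * 5 / 162 < 36]. *)
have hA : 162 * n ^+ 9 <= A.
  have h (k : 'I_(4 * N).+3) : (N.+1 <= k < (3 * N).+1)%N ->
      81 * n ^+ 8 <= a k ^+ 2.
    case: k => -[//|j] /= _ /andP[h1 h2]; rewrite ltnS in h1; rewrite ltnS in h2.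
    rewrite aS; last lia.
    have y0 : n <= j%:R by rewrite /n ler_nat.
    have y1 : j%:R <= 3 * n by rewrite /n -natrM ler_nat ltnW.
    have h3 : 3 * n ^+ 2 <= j%:R * (4 * n - j%:R) by nra.
    have -> : 81 * n ^+ 8 = (3 * n ^+ 2) ^+ 4 by ring.
    rewrite /F -exprM; apply: lerXn2r => //; rewrite nnegrE.
      by rewrite mulr_ge0 // exprn_ge0 //; lra.
    apply: le_trans h3; by rewrite mulr_ge0 // exprn_ge0 //; lra.
  rewrite /A (bigID (fun k : 'I_(4 * N).+3 => (N.+1 <= k < (3 * N).+1)%N)) /=.
  rewrite -[leLHS]addr0; apply: lerD; last first.
    by apply: sumr_ge0 => k _; apply: sqr_ge0.
  apply: le_trans (ler_sum _ h).
  rewrite -(big_mkord (fun k => (N.+1 <= k < (3 * N).+1)%N) (fun _ => 81 * n ^+ 8)).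
  have NL : (N.+1 <= (4 * N).+3)%N by lia.
  have NL2 : ((3 * N).+1 <= (4 * N).+3)%N by lia.
  rewrite -[X in _ <= X](_ : \sum_(N.+1 <= k < (3 * N).+1) 81 * n ^+ 8 = _); last first.
    by rewrite (@big_nat_widenl _ _ _ _ 0) // (big_nat_widen _ _ (4 * N).+3) //.
  rewrite sumr_const_nat -[leRHS]mulr_natr.
  have -> : ((3 * N).+1 - N.+1 = 2 * N)%N by lia.
  by rewrite natrM -/n; lra.
have A0 : 0 < A.
  by apply: lt_le_trans hA; rewrite mulr_gt0 // exprn_gt0 //; lra.
pose r := Num.sqrt A; have r0 : r != 0 by rewrite gt_eqF // sqrtr_gt0.
have r2 : r ^+ 2 = A by rewrite sqr_sqrtr // ltW.
have hN : (4 * N).+1%:R <= 5 * n by rewrite -natr1 natrM -/n; lra.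
exists (fun k => a k / r); split.
- by rewrite a0 a1 a2 a3 mul0r.
- rewrite (eq_bigr (fun k : 'I__ => a k ^+ 2 / A)).
    by rewrite -mulr_suml divff // gt_eqF.
  by move=> k _; rewrite expr_div_n r2.
- rewrite (eq_bigr (fun j : 'I__ => (a j.+2 - a j.+1) ^+ 2 / A)); last first.
    by move=> k _; rewrite -mulrBl expr_div_n r2.
  rewrite -mulr_suml ler_pdivrMr // -/n.
  apply: le_trans (ler_sum _ (fun j _ => d1 j)) _.
  rewrite sumr_const card_ord -[leLHS]mulr_natr.
  apply: le_trans (_ : (32 * n ^+ 3) ^+ 2 * (5 * n) <= _).
    by apply: ler_wpM2l => //; apply: sqr_ge0.
  apply: le_trans (_ : 32 / n ^+ 2 * (162 * n ^+ 9) <= _).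
    have -> : 32 / n ^+ 2 * (162 * n ^+ 9) = 5184 * n ^+ 7.
      by field; apply/eqP; lra.
    have : 0 <= n ^+ 7 by rewrite exprn_ge0 //; lra.
    lra.
  by apply: ler_wpM2l => //; rewrite divr_ge0 // exprn_ge0 //; lra.
- rewrite (eq_bigr (fun j : 'I__ => (a j.+2 - 2 * a j.+1 + a j) ^+ 2 / A)); last first.
    by move=> k _; rewrite mulrA -mulrBl -mulrDl expr_div_n r2.
  rewrite -mulr_suml ler_pdivrMr // -/n.
  apply: le_trans (ler_sum _ (fun j _ => d2 j)) _.
  rewrite sumr_const card_ord -[leLHS]mulr_natr.
  apply: le_trans (_ : (34 * n ^+ 2) ^+ 2 * (5 * n) <= _).
    by apply: ler_wpM2l => //; apply: sqr_ge0.
  apply: le_trans (_ : 36 / n ^+ 4 * (162 * n ^+ 9) <= _).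
    have -> : 36 / n ^+ 4 * (162 * n ^+ 9) = 5832 * n ^+ 5.
      by field; apply/eqP; lra.
    have : 0 <= n ^+ 5 by rewrite exprn_ge0 //; lra.
    lra.
  by apply: ler_wpM2l => //; rewrite divr_ge0 // exprn_ge0 //; lra.
Qed.

End Window.

(** * Measuring in an eigenbasis of a path *)

Section MatrixOps.
Variable R : realType.
Local Notation C := (R[i]).

Definition mxop (d : nat) (P : 'M[C]_d) (v : 'I_d -> C) : 'I_d -> C :=
  fun y => \sum_k P y k * v k.

Lemma mxopM d (P Q : 'M[C]_d) v : mxop (P *m Q) v = mxop P (mxop Q v).
Proof.
apply: funext => y; rewrite /mxop; under eq_bigr do rewrite mxE mulr_suml.
rewrite exchange_big; apply: eq_bigr => k _ /=; rewrite mulr_sumr.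
by apply: eq_bigr => j _; rewrite mulrA.
Qed.

Lemma mxop1 d (v : 'I_d -> C) : mxop 1%:M v = v.
Proof.
apply: funext => y; rewrite /mxop (bigD1 y) //= big1 ?addr0.
  by rewrite mxE eqxx mul1r.
by move=> k /negbTE h; rewrite mxE eq_sym h mul0r.
Qed.

Lemma uop_mxop d (P : 'M[C]_d) : unitary P -> uop (mxop P) (mxop (adjmx P)).
Proof.
case=> h1 h2; split=> [u v|v|v].
- rewrite /dot /mxop; under eq_bigr do rewrite rmorph_sum mulr_suml.
  rewrite exchange_big; apply: eq_bigr => k _ /=; rewrite mulr_sumr.
  by apply: eq_bigr => j _; rewrite rmorphM !mxE /=; ring.
- by rewrite -mxopM h2 mxop1.
- by rewrite -mxopM h1 mxop1.
Qed.

Lemma conjCE (z : C) : Num.conj z = conjc z.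
Proof.
have [->|z0] := eqVneq z 0; first by rewrite !rmorph0.
by apply: (mulfI z0); rewrite -normCK sqr_normc.
Qed.

(** A measurement after [U] with outcome [y] reads the eigenvalue [lam y]. Existence is enough: [U]
    enters a circuit as a free gate. *)
Lemma real_symmetric_spectrum d (S : 'I_d -> 'I_d -> R) :
  (forall i j, S i j = S j i) ->
  exists (U V : ('I_d -> C) -> 'I_d -> C) (lam : 'I_d -> R), uop U V /\
    forall v y, U (fun i => \sum_j (S i j)%:C%C * v j) y = (lam y)%:C%C * U v y.
Proof.
move=> Ssym; pose A : 'M[C]_d := \matrix_(i, j) (S i j)%:C%C.
have Ah : A \is hermsymmx.
  apply/is_hermitianmxP; rewrite expr0 scale1r; apply/matrixP => i j.
  by rewrite !mxE conjCE conjc_real Ssym.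
have /hermitian_normalmx/orthomx_spectralP AE := Ah.
have Dr := hermitian_spectral_diag_real Ah.
set P := spectralmx A in AE; set D := spectral_diag A in AE Dr.
have Pu : P \is unitarymx := spectral_unitarymx A.
have PP : P *m adjmx P = 1%:M.
  rewrite -[RHS](unitarymxP Pu) /adjmx; congr (_ *m _).
  by apply/matrixP => i j; rewrite !mxE conjCE.
exists (mxop P), (mxop (adjmx P)), (fun y => complex.Re (D 0 y)); split.
  by apply: uop_mxop; split=> //; apply: mulmx1C.
move=> v y; have -> : (fun i => \sum_j (S i j)%:C%C * v j) = mxop A v.
  by apply: funext => i; apply: eq_bigr => j _; rewrite mxE.
rewrite -mxopM AE !mulmxA mulmxV ?mul1mx ?spectral_unit // mxopM.
rewrite {1}/mxop (bigD1 y) //= big1 ?addr0; last first.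
  by move=> k h; rewrite mxE eq_sym (negbTE h) mulr0n mul0r.
by rewrite mxE eqxx mulr1n RRe_real //; apply: (mxOverP Dr).
Qed.

End MatrixOps.

Section Moment.
Variable R : realType.
Local Notation C := (R[i]).

(* Half the adjacency matrix of the path on [d] vertices. *)
Definition path_adj (d : nat) (i j : 'I_d) : R :=
  (if i.+1 == j then 2^-1 else 0) + (if j.+1 == i then 2^-1 else 0).

Lemma path_adjC d (i j : 'I_d) : path_adj i j = path_adj j i.
Proof. by rewrite /path_adj addrC. Qed.

Lemma path_adj_sum d (f : nat -> C) (i : 'I_d) :
  \sum_(j < d) (path_adj i j)%:C%C * f j =
  (if (i.+1 < d)%N then (2^-1)%:C%C * f i.+1 else 0) +
  (if (i : nat) is k.+1 then (2^-1)%:C%C * f k else 0).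
Proof.
have h (m : nat) : \sum_(j < d) (if m == j then 2^-1 else 0)%:C%C * f j =
    if (m < d)%N then (2^-1)%:C%C * f m else 0.
  case: ltnP => md; last first.
    rewrite big1 // => j _; case: eqP => [e|_]; last by rewrite rmorph0 mul0r.
    by move: (ltn_ord j); rewrite -e ltnNge md.
  rewrite (bigD1 (Ordinal md)) //= eqxx big1 ?addr0 // => j /eqP jm.
  case: eqP => [e|_]; last by rewrite rmorph0 mul0r.
  by case: jm; apply: val_inj.
rewrite -h; case: i => -[|k] ki /=.
  rewrite addr0; apply: eq_bigr => j _; rewrite /path_adj /=.
  by rewrite addr0.
have := h k; rewrite (ltnW ki) => <-; rewrite -big_split; apply: eq_bigr => j _.
rewrite /path_adj /= rmorphD mulrDl; congr (_ + _).
by rewrite eqSS eq_sym.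
Qed.

Variables (Z : finType) (w : nat -> Z -> C) (x : R) (d : nat) (c : nat -> R).
Hypotheses (wrec : forall k, w k.+2 = fun z => (2 * x)%:C%C * w k.+1 z + (-1) * w k z)
  (w1 : forall k, nrm2 (w k) = 1)
  (wgap : forall k, nrm2 (fun z => w k.+2 z - w k z) = 4 * (1 - x ^+ 2))
  (c0 : c 0%N = 0) (c1 : c 1%N = 0) (cd : c d = 0) (cd1 : c d.+1 = 0).

Lemma qpe_moment :
  \sum_z nrm2 (fun k : 'I_d.+2 =>
     \sum_j (path_adj k j)%:C%C * ((c j)%:C%C * w j z) - x%:C%C * ((c k)%:C%C * w k z))
  <= 2^-1 * (\sum_(j < d) (c j.+2 - 2 * c j.+1 + c j) ^+ 2)
     + 2 * (1 - x ^+ 2) * (\sum_(j < d) (c j.+2 - c j.+1) ^+ 2).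
Proof.
(* By [wrec] the residual at an interior vertex is a combination of finite
   differences of [c]; at the two ends it vanishes. *)
pose val (j : nat) z := (2^-1 * (c j.+2 - 2 * c j.+1 + c j))%:C%C * w j z
   + (2^-1 * (c j.+2 - c j.+1))%:C%C * (w j.+2 z - w j z).
have e z (k : 'I_d.+2) : \sum_j (path_adj k j)%:C%C * ((c j)%:C%C * w j z)
    - x%:C%C * ((c k)%:C%C * w k z) =
    if (0 < k < d.+1)%N then val k.-1 z else 0.
  rewrite (path_adj_sum (fun j => (c j)%:C%C * w j z)).
  case: k => -[|k] kd /=; first by rewrite c0 c1 !(rmorph0, mul0r, mulr0, if_same, addr0, subr0).
  rewrite !ltnS; case: ltnP => kd'; last first.
    have -> : k = d by apply/eqP; rewrite eqn_leq kd' -ltnS -ltnS kd.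
    by rewrite cd cd1 !(rmorph0, mul0r, mulr0, addr0, subr0).
  have e : (2 * x)%:C%C * w k.+1 z = w k.+2 z + w k z by rewrite wrec; ring.
  have -> : x%:C%C * ((c k.+1)%:C%C * w k.+1 z)
     = (2^-1 * c k.+1)%:C%C * (w k.+2 z + w k z).
    rewrite -e !rmorphM fmorphV rmorph_nat; by field.
  rewrite /val !rmorphM !rmorphD !rmorphN !rmorphM fmorphV rmorph_nat; by field.
under eq_bigr => z _ do rewrite /nrm2; rewrite exchange_big /=.
under eq_bigr => k _ do under eq_bigr => z _ do rewrite e.
rewrite big_ord_recl /= big1; last by move=> z _; rewrite /= expr0n addr0.
rewrite big_ord_recr /= [X in _ + (_ + X)]big1; last first.
  by move=> z _; rewrite /bump /= add1n ltnn /= expr0n addr0.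
rewrite add0r addr0 !mulr_sumr -big_split /=; apply: ler_sum => j _.
rewrite /bump /= add1n !ltnS ltn_ord.
(* The second difference multiplies a unit vector and the first difference multiplies the small
   vector of [wgap]. *)
apply: le_trans (_ : \sum_z (2 * ((2^-1 * (c j.+2 - 2 * c j.+1 + c j)) ^+ 2 * sqmod (w j z))
   + 2 * ((2^-1 * (c j.+2 - c j.+1)) ^+ 2 * sqmod (w j.+2 z - w j z))) <= _).
  apply: ler_sum => z _; apply: le_trans (sqmodD_le _ _) _.
  by rewrite !sqmodM !sqmodR.
rewrite big_split -!mulr_sumr /=.
have := w1 j; have := wgap j; rewrite /nrm2 => -> ->.
by rewrite le_eqVlt; apply/orP; left; apply/eqP; field.
Qed.

End Moment.

(** * Query circuits *)

Section Circuits.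
Variable R : realType.
Local Notation C := (R[i]).
Local Notation vec T := (T -> C).
Variable Q : finType.

(** The oracle is not part of the syntax, so a circuit is fixed before any oracle is given. A [Free]
    gate carries its inverse with a proof, which makes inversion of circuits a syntactic
    operation. *)
Inductive gate (T : finType) : Type :=
  | Ask
  | AskV
  | Free (U V : vec (Q * T)%type -> vec (Q * T)%type) of uop U V.

Arguments Ask {T}.
Arguments AskV {T}.

Definition inv_gate (T : finType) (g : gate T) : gate T :=
  match g with Ask => AskV | AskV => Ask | Free U V h => Free (uopV h) end.

Definition inv_circ (T : finType) (gs : seq (gate T)) := rev (map (@inv_gate T) gs).

Definition is_ask (T : finType) (g : gate T) := if g is Free _ _ _ then false else true.

Definition queries (T : finType) (gs : seq (gate T)) := count (@is_ask T) gs.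

Definition ask (T : finType) (o : vec Q -> vec Q) (v : vec (Q * T)%type) : vec (Q * T)%type :=
  fun z => o (fun q => v (q, z.2)) z.1.

Lemma queries_cat (T : finType) (gs hs : seq (gate T)) :
  queries (gs ++ hs) = (queries gs + queries hs)%N.
Proof. exact: count_cat. Qed.

Lemma queries_inv (T : finType) (gs : seq (gate T)) : queries (inv_circ gs) = queries gs.
Proof. by rewrite /queries count_rev count_map; apply: eq_count => -[]. Qed.

Section Lift.
Variables (T T' S : finType) (f : T' -> T * S) (g : T * S -> T').
Hypotheses (fK : cancel f g) (gK : cancel g f).

Definition lift_to (z : Q * T') : (Q * T) * S :=
  ((z.1, (f z.2).1), (f z.2).2).
Definition lift_from (y : (Q * T) * S) : Q * T' := (y.1.1, g (y.1.2, y.2)).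

Lemma lift_toK : cancel lift_to lift_from.
Proof. by case=> q t; rewrite /lift_from /= -surjective_pairing fK. Qed.

Lemma lift_fromK : cancel lift_from lift_to.
Proof. by case=> -[q t] s; rewrite /lift_to /= gK. Qed.

Definition lift_gate (h : gate T) : gate T' :=
  match h with
  | Ask => Ask
  | AskV => AskV
  | Free U V UV => Free (uop_block lift_toK lift_fromK (fun _ : S => UV))
  end.

End Lift.

Variables o o' : vec Q -> vec Q.

Definition gate_op (T : finType) (h : gate T) : vec (Q * T)%type -> vec (Q * T)%type :=
  match h with Ask => ask o | AskV => ask o' | Free U _ _ => U end.

Definition run (T : finType) (gs : seq (gate T)) (v : vec (Q * T)%type) :=
  foldl (fun v h => gate_op h v) v gs.

Lemma run_cat (T : finType) (gs hs : seq (gate T)) v : run (gs ++ hs) v = run hs (run gs v).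
Proof. exact: foldl_cat. Qed.

Lemma run_lift (T T' S : finType) (f : T' -> T * S) (g : T * S -> T')
    (fK : cancel f g) (gK : cancel g f) (gs : seq (gate T)) s v :
  slice (lift_from g) s (run (map (lift_gate fK gK) gs) v)
  = run gs (slice (lift_from g) s v).
Proof.
elim: gs v => //= h gs IH v; rewrite IH; congr (run gs _).
case: h => //= U V UV; exact: slice_block (lift_fromK _) _ _ _.
Qed.

Hypothesis oo' : uop o o'.

Lemma uop_ask (T : finType) (p p' : vec Q -> vec Q) : uop p p' -> uop (@ask T p) (@ask T p').
Proof.
move=> pp'; have K : cancel (@id (Q * T)) id by [].
by apply: (uop_block K K (A := fun _ => p) (B := fun _ => p')).
Qed.

Lemma uop_gate (T : finType) (h : gate T) : uop (gate_op h) (gate_op (inv_gate h)).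
Proof. by case: h => //=; apply: uop_ask => //; apply: uopV. Qed.

Lemma uop_run (T : finType) (gs : seq (gate T)) : uop (run gs) (run (inv_circ gs)).
Proof.
elim: gs => [|h gs IH]; first exact: uop_id.
have -> : run (inv_circ (h :: gs))
   = fun v => gate_op (inv_gate h) (run (inv_circ gs) v).
  by apply: funext => v; rewrite /inv_circ /= rev_cons -cats1 run_cat.
exact: (uop_comp (uop_gate h) IH).
Qed.

End Circuits.

Arguments Ask {R Q T}.
Arguments AskV {R Q T}.

(** * Estimators with bounded failure probability *)

Section Estimable.
Variable R : realType.
Local Notation C := (R[i]).
Local Notation vec T := (T -> C).
Variables (Q : finType) (q0 : Q) (n : nat) (lab : Q -> 'I_n).

(** What a circuit sees of the oracle: measuring the label of [o (delta R q0)] samples from [p]. *)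
Definition samples (p : 'I_n -> R) (o o' : vec Q -> vec Q) : Prop :=
  uop o o' /\ forall i, \sum_(q | lab q == i) sqmod (o (delta R q0) q) = p i.

(** The circuit and the read-out [f] are chosen before [p] and the oracle. The probability of
    failure, rather than success, is bounded so that errors add up over several estimators. *)
Definition estimable (N : nat) (tau : ('I_n -> R) -> R) (e err : R) : Prop :=
  exists (T : finType) (t0 : T) (gs : seq (gate R Q T)) (f : Q * T -> R),
    (queries gs <= N)%N /\ forall p, prob_dist p -> forall o o', samples p o o' ->
    \sum_(z | e < `|f z - tau p|) sqmod (run o o' gs (delta R (q0, t0)) z) <= err.

Lemma estimable_trivial (tau : ('I_n -> R) -> R) (a e : R) :
  (forall p, prob_dist p -> `|a - tau p| <= e) -> estimable 0 tau e 0.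
Proof.
move=> h; exists unit, tt, [::], (fun=> a); split=> // p pp o o' _.
by rewrite big1 // => z; rewrite ltNge h.
Qed.

Lemma estimable_weaken N N' tau e err err' : (N <= N')%N -> err <= err' ->
  estimable N tau e err -> estimable N' tau e err'.
Proof.
move=> NN' ee' [T [t0 [gs [f [qs h]]]]]; exists T, t0, gs, f; split.
  exact: leq_trans NN'.
by move=> p pp o o' s; apply: le_trans (h p pp o o' s) ee'.
Qed.

Lemma estimable_shift N tau tau' e d err :
  (forall p, prob_dist p -> `|tau p - tau' p| <= d) ->
  estimable N tau e err -> estimable N tau' (e + d) err.
Proof.
move=> td [T [t0 [gs [f [qs h]]]]]; exists T, t0, gs, f; split=> //.
move=> p pp o o' s; apply: le_trans (h p pp o o' s).
rewrite big_mkcond [leRHS]big_mkcond /=; apply: ler_sum => z _.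
case: ifP => [h1|_]; last by case: ifP => // _; apply: sqmod_ge0.
rewrite ifT // -(ltrD2r d); apply: lt_le_trans h1 _.
have -> : f z - tau' p = (f z - tau p) + (tau p - tau' p) by ring.
by apply: le_trans (ler_normD _ _) _; rewrite lerD2l td.
Qed.

(** The two circuits run one after the other on disjoint registers, so the final state is a product
    and the union bound applies. *)
Lemma estimableD N1 N2 tau1 tau2 e1 e2 err1 err2 :
  estimable N1 tau1 e1 err1 -> estimable N2 tau2 e2 err2 ->
  estimable (N1 + N2) (fun p => tau1 p + tau2 p) (e1 + e2) (err1 + err2).
Proof.
case=> T1 [t1 [gs1 [f1 [qs1 h1]]]] [T2 [t2 [gs2 [f2 [qs2 h2]]]]].
pose T := (T1 * (Q * T2))%type.
have K1 : cancel (@id T) id by [].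
pose f (z : T) : T2 * (T1 * Q) := (z.2.2, (z.1, z.2.1)).
pose g (z : T2 * (T1 * Q)) : T := (z.2.1, (z.2.2, z.1)).
have fK : cancel f g by case=> a [b c].
have gK : cancel g f by case=> a [b c].
(* All queries act on the one register [Q]; the swap stores the first result and brings in a fresh
   copy, still in state [q0], for the second circuit. *)
pose sw (z : Q * T) : Q * T := (z.2.2.1, (z.2.1, (z.1, z.2.2.2))).
have swK : cancel sw sw by case=> a [b [c d]].
exists T, (t1, (q0, t2)), (map (lift_gate K1 K1) gs1 ++ Free (uop_permop R swK swK)
   :: map (lift_gate fK gK) gs2), (fun z => f1 (z.2.2.1, z.2.1) + f2 (z.1, z.2.2.2)).
have ql (S S1 S2 : finType) (F : S -> S1 * S2) G (FK : cancel F G) (GK : cancel G F)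
    (gs : seq (gate R Q S1)) :
    queries (map (lift_gate FK GK) gs) = queries gs.
  by rewrite /queries count_map; apply: eq_count => -[].
split; first by rewrite queries_cat /= !ql add0n leq_add.
move=> p pp o o' s; have [oo' _] := s.
set psi1 := run o o' gs1 (delta R (q0, t1)).
set psi2 := run o o' gs2 (delta R (q0, t2)).
have lin (S : finType) (gs : seq (gate R Q S)) (a : C) v :
    run o o' gs (fun z => a * v z) = fun z => a * run o o' gs v z.
  have := uop_lin (uop_run oo' gs) v v a 0.
  have -> : (fun t => a * v t + 0 * v t) = (fun t => a * v t).
    by apply: funext => t; rewrite mul0r addr0.
  by move=> ->; apply: funext => t; rewrite mul0r addr0.
have E z : run o o' (map (lift_gate K1 K1) gs1 ++ Free (uop_permop R swK swK)
   :: map (lift_gate fK gK) gs2) (delta R (q0, (t1, (q0, t2)))) z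
   = psi1 (z.2.2.1, z.2.1) * psi2 (z.1, z.2.2.2).
  rewrite run_cat /=; set v1 := run o o' (map _ gs1) _.
  have v1E q a q' b : v1 (q, (a, (q', b))) = ((q', b) == (q0, t2))%:R * psi1 (q, a).
    rewrite -[LHS]/(slice (lift_from id) (q', b) v1 (q, a)) run_lift.
    rewrite (_ : slice _ _ _ = fun z => ((q', b) == (q0, t2))%:R * delta R (q0, t1) z).
      by rewrite lin.
    apply: funext => -[r c]; rewrite /slice /delta /lift_from /= !xpair_eqE.
    by case: (r == q0); case: (c == t1); rewrite ?(mul0r, mulr0, mul1r, mulr1) //= ?andbF.
  case: z => q [a [q' b]] /=.
  rewrite -[LHS]/(slice (lift_from g) (a, q') (run o o' (map (lift_gate fK gK) gs2)
     (permop sw v1)) (q, b)) run_lift.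
  rewrite (_ : slice _ _ _ = fun z => psi1 (q', a) * delta R (q0, t2) z).
    by rewrite lin.
  apply: funext => -[r c]; rewrite /slice /lift_from /permop /sw /g /= v1E.
  by rewrite mulrC.
have n1 : nrm2 psi1 = 1 by rewrite (uop_nrm2 (uop_run oo' gs1)) delta_nrm2.
have n2 : nrm2 psi2 = 1 by rewrite (uop_nrm2 (uop_run oo' gs2)) delta_nrm2.
under eq_bigr do rewrite E sqmodM.
pose b1 (z : Q * T1) := e1 < `|f1 z - tau1 p|.
pose b2 (z : Q * T2) := e2 < `|f2 z - tau2 p|.
pose F (z1 : Q * T1) (z2 : Q * T2) := sqmod (psi1 z1) * sqmod (psi2 z2).
have F0 z1 z2 : 0 <= F z1 z2 by rewrite mulr_ge0 ?sqmod_ge0.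
pose H (z1 : Q * T1) (z2 : Q * T2) := (if b1 z1 then F z1 z2 else 0)
   + (if b2 z2 then F z1 z2 else 0).
apply: le_trans (_ : \sum_z1 \sum_z2 H z1 z2 <= _).
  rewrite pair_big big_mkcond /=.
  rewrite [leRHS](reindex (fun z : Q * T => ((z.2.2.1, z.2.1), (z.1, z.2.2.2)))) /=; last first.
    exists (fun y => (y.2.1, (y.1.2, (y.1.1, y.2.2)))); first by case=> ? [? [? ?]].
    by case=> -[? ?] [? ?].
  apply: ler_sum => z _; rewrite -/(F _ _) /H.
  case: ifP => [h|_]; last by apply: addr_ge0; case: ifP.
  rewrite /b1 /b2; case: ltP => k1; first by rewrite lerDl; case: ifP.
  case: ltP => k2; first by rewrite add0r.
  suff : e1 + e2 < e1 + e2 by rewrite ltxx.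
  apply: lt_le_trans h _; apply: le_trans (lerD k1 k2).
  by rewrite opprD addrACA; apply: ler_normD.
have -> : \sum_z1 \sum_z2 H z1 z2 =
    (\sum_(z | b1 z) sqmod (psi1 z)) * nrm2 psi2 + nrm2 psi1 * (\sum_(z | b2 z) sqmod (psi2 z)).
  rewrite /H; under eq_bigr do rewrite big_split /=.
  rewrite big_split /=; congr (_ + _).
    rewrite [X in _ = X * _]big_mkcond mulr_suml; apply: eq_bigr => z1 _.
    by case: ifP => _; [rewrite /F /nrm2 mulr_sumr | rewrite mul0r big1].
  rewrite /nrm2 mulr_suml; apply: eq_bigr => z1 _.
  by rewrite -big_mkcond /F mulr_sumr.
by rewrite n1 n2 mulr1 mul1r lerD // ?h1 ?h2.
Qed.

Lemma estimable_sum J N tau e err :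
  (forall j, (j < J)%N -> estimable (N j) (tau j) (e j) (err j)) ->
  estimable (\sum_(j < J) N j) (fun p => \sum_(j < J) tau j p)
    (\sum_(j < J) e j) (\sum_(j < J) err j).
Proof.
elim: J => [|J IH] h.
  rewrite !big_ord0; apply: (estimable_trivial (a := 0)) => p _.
  by rewrite big_ord0 subrr normr0.
rewrite !big_ord_recr /=.
rewrite (_ : (fun p => _) = fun p => \sum_(j < J) tau j p + tau J p); last first.
  by apply: funext => p; rewrite big_ord_recr.
by apply: estimableD; [apply: IH => j jJ; apply/h/ltnW|apply: h].
Qed.

End Estimable.

(** * The inner circuit *)

Section Powers.
Variable R : realType.
Local Notation C := (R[i]).
Local Notation vec T := (T -> C).

Lemma uop_scale (T : finType) (A B : vec T -> vec T) (a : C) v : uop A B ->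
  A (fun t => a * v t) = fun t => a * A v t.
Proof.
move=> AB; have := uop_lin AB v v a 0.
have -> : (fun t => a * v t + 0 * v t) = (fun t => a * v t).
  by apply: funext => t; rewrite mul0r addr0.
by move=> ->; apply: funext => t; rewrite mul0r addr0.
Qed.

(** This implements the reflection about a prepared state: undo the preparation, flip the signs off
    the initial basis vector, prepare again. *)
Lemma refl_conj (T : finType) (A B : vec T -> vec T) u w : uop A B ->
  A (refl u (B w)) = refl (A u) w.
Proof.
move=> AB; have [h _ BA] := AB.
have -> : refl u (B w) = fun t => (2 * dot (A u) w) * u t + (-1) * B w t.
  by apply: funext => t; rewrite /refl h mulN1r.
by rewrite (uop_lin AB) BA; apply: funext => t; rewrite /refl mulN1r.
Qed.

Lemma refl_delta (T : finType) (t0 : T) w :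
  refl (delta R t0) w = sgnop (fun t => t != t0) w.
Proof.
apply: funext => t; rewrite /refl /sgnop dot_delta /delta.
by case: eqVneq => [->|_] /=; ring.
Qed.

Variables (T I : finType) (u : vec T) (e : I -> nat) (G : I -> vec T -> vec T)
  (uG : forall i, exists G', uop (G i) G').

(* Round [t] of a controlled power: exactly the indices [i] with [t < e i]
   receive one more factor [G i]. *)
Lemma ctl_power (round : nat -> (I -> vec T) -> I -> vec T) (a : I -> C) t v :
  (forall t v i, round t v i = if (t < e i)%N then G i (v i) else v i) ->
  (forall i, v i = fun z => a i * u z) ->
  forall i, foldl (fun v t => round t v) v (iota 0 t) i
            = fun z => a i * iter (minn (e i) t) (G i) u z.
Proof.
move=> rE v0; elim: t => [|t IH] i.
  by rewrite [foldl _ _ _]/= v0 minn0.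
rewrite -[in iota _ _]addn1 iotaD add0n foldl_cat [foldl _ _ (iota _ 1)]/= rE IH.
case: ltnP => ti.
  have [G' GG'] := uG i; rewrite (uop_scale _ _ GG').
  by rewrite (minn_idPr ti).
by rewrite (minn_idPl (leqW ti)).
Qed.

Lemma dot_nrefl (u' w : vec T) :
  dot w (nrefl u' w) = (nrm2 w - 2 * sqmod (dot u' w))%:C%C.
Proof.
have -> : nrefl u' w = fun t => 1 * w t + (- (2 * dot u' w)) * u' t.
  by apply: funext => t; rewrite /nrefl; ring.
rewrite dotDr -nrm2E mul1r -[dot w u']dotC rmorphB rmorphM /= sqmodE rmorph_nat.
ring.
Qed.

End Powers.

Lemma queries_flatten (R : realType) (Q T : finType) (f : nat -> seq (gate R Q T))
    (c : nat) (ts : seq nat) : (forall t, queries (f t) = c) ->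
  queries (flatten [seq f t | t <- ts]) = (c * size ts)%N.
Proof.
move=> h; elim: ts => [|t ts IH]; first by rewrite muln0.
by rewrite [flatten _]/= queries_cat h IH mulnS.
Qed.

Section BlockCircuit.
Variable R : realType.
Local Notation C := (R[i]).
Local Notation vec T := (T -> C).
Variables (Q : finType) (q0 : Q) (n : nat) (lab : Q -> 'I_n).
Variables (S : finType) (s0 : S) (cS : S -> R) (eS : S -> nat) (E : nat).
Hypotheses (cS1 : \sum_s cS s ^+ 2 = 1) (eSE : forall s, (eS s <= E)%N).

Local Notation TI := (Q * S)%type.

Section Inner.
Variables (prep prepV : vec S -> vec S).
Hypotheses (uprep : uop prep prepV)
  (prepE : prep (delta R s0) = fun s => (cS s)%:C%C).

Definition to_S (z : Q * TI) : S * (Q * Q) := (z.2.2, (z.1, z.2.1)).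
Definition from_S (y : S * (Q * Q)) : Q * TI := (y.2.1, (y.2.2, y.1)).
Lemma to_SK : cancel to_S from_S. Proof. by case=> ? []. Qed.
Lemma from_SK : cancel from_S to_S. Proof. by case=> ? []. Qed.

Definition swapQ (z : Q * TI) : Q * TI := (z.2.1, (z.1, z.2.2)).
Lemma swapQK : cancel swapQ swapQ. Proof. by case=> ? []. Qed.

(** The second [Q] register holds a sample whose label plays the role of [a]; comparing labels
    applies [1 - 2 Pi_a] for all [a] in superposition. *)
Definition mark (t : nat) (z : Q * TI) := (t < eS z.2.2)%N && (lab z.1 == lab z.2.1).
Definition away (t : nat) (z : Q * TI) := (t < eS z.2.2)%N && (z.1 != q0).

(* When the signs are switched off the two queries cancel, so the power is
   controlled although the queries themselves are not. *)
Definition inner_round (t : nat) : seq (gate R Q TI) :=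
  [:: Free (uop_sgnop R (mark t)); AskV; Free (uop_sgnop R (away t)); Ask].

(** One query draws the sample that fixes [a], the swap sets it aside, and a second query prepares
    the vector on which the powers act. *)
Definition inner_prep : seq (gate R Q TI) :=
  [:: Ask; Free (uop_permop R swapQK swapQK); Ask;
      Free (uop_block to_SK from_SK (fun _ => uprep))].

Definition inner : seq (gate R Q TI) :=
  inner_prep ++ flatten [seq inner_round t | t <- iota 0 E].

Lemma queries_inner : queries inner = (2 + 2 * E)%N.
Proof.
by rewrite queries_cat (queries_flatten (c := 2)) // size_iota.
Qed.

Variables (o o' : vec Q -> vec Q).
Hypothesis oo' : uop o o'.
Local Notation u := (o (delta R q0)).
Local Notation bad i := (sgnop (fun q => lab q == i)).

Definition sampleG (i : 'I_n) : vec Q -> vec Q := grover u (bad i).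

Lemma oracle_nrm2 : nrm2 u = 1.
Proof. by rewrite (uop_nrm2 oo') delta_nrm2. Qed.

Lemma uop_sampleG i : exists G', uop (sampleG i) G'.
Proof. by eexists; apply: uop_grover oracle_nrm2 (uop_sgnop _ _). Qed.

Lemma run_inner : run o o' inner (delta R (q0, (q0, s0))) =
  fun z => ((cS z.2.2)%:C%C * u z.2.1) * iter (eS z.2.2) (sampleG (lab z.2.1)) u z.1.
Proof.
(* [sl] and [gl] curry the state into a family of vectors on the query register, the form on which
   [ctl_power] acts branch by branch. *)
pose sl (v : vec (Q * TI)%type) (i : TI) : vec Q := fun q => v (q, i).
pose gl (f : TI -> vec Q) : vec (Q * TI)%type := fun z => f z.2 z.1.
have slK f : sl (gl f) = f by [].
have glK v : gl (sl v) = v by apply: funext => -[].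
have pE : run o o' inner_prep (delta R (q0, (q0, s0))) =
    fun z => (cS z.2.2)%:C%C * u z.2.1 * u z.1.
  rewrite /=; set v1 := ask o (delta R _).
  have v1E : v1 = fun z => ((z.2.1 == q0) && (z.2.2 == s0))%:R * u z.1.
    apply: funext => -[q [d s]]; rewrite /v1 /ask /=.
    rewrite (_ : (fun q => _) = fun q => ((d == q0) && (s == s0))%:R * delta R q0 q).
      by rewrite (uop_scale _ _ oo').
    apply: funext => q'; rewrite /delta -pair_eqE /= xpair_eqE.
    by case: (q' == q0); case: (d == q0); case: (s == s0); rewrite /= ?(mulr1, mulr0).
  rewrite v1E; set v2 := ask o _.
  have v2E : v2 = fun z => u z.2.1 * (z.2.2 == s0)%:R * u z.1.
    apply: funext => -[q [d s]]; rewrite /v2 /ask /permop /swapQ /=.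
    rewrite (_ : (fun q => _) = fun q => (u d * (s == s0)%:R) * delta R q0 q).
      by rewrite (uop_scale _ _ oo').
    apply: funext => q'; rewrite /delta.
    by case: (q' == q0); case: (s == s0) => /=; ring.
  rewrite v2E; apply: funext => -[q [d s]]; rewrite /block /to_S /=.
  rewrite (_ : slice _ _ _ = fun s => (u d * u q) * delta R s0 s); last first.
    by apply: funext => s'; rewrite /slice /from_S /delta /=; ring.
  by rewrite (uop_scale _ _ uprep) prepE; ring.
rewrite /inner run_cat pE.
pose round t (f : TI -> vec Q) := sl (run o o' (inner_round t) (gl f)).
have runE ts v : run o o' (flatten [seq inner_round t | t <- ts]) v
    = gl (foldl (fun f t => round t f) (sl v) ts).
  elim: ts v => [|t ts IH] v; first by rewrite /= glK.
  by rewrite -[flatten _]/(inner_round t ++ flatten [seq inner_round t | t <- ts]) run_cat IH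
       [in RHS]/= /round glK.
rewrite runE; apply: funext => -[q [d s]]; rewrite /gl.
rewrite (@ctl_power R Q TI u (fun i => eS i.2) (fun i => sampleG (lab i.1)) _ round
  (fun i => (cS i.2)%:C%C * u i.1)) //.
- by rewrite /= (minn_idPl (eSE s)).
- by move=> i; apply: uop_sampleG.
move=> t f [d' s']; rewrite /round /sl /gl /inner_round /= /ask /=.
have [h1 h2 h3] := oo'.
case: ltnP => ts.
  rewrite /sampleG /grover -(refl_conj _ _ oo') refl_delta.
  congr o; apply: funext => x; rewrite /sgnop /away /= ts /=.
  have -> : (fun q1 => if mark t (q1, (d', s')) then - f (d', s') q1 else f (d', s') q1)
     = (fun q1 => if lab q1 == lab d' then - f (d', s') q1 else f (d', s') q1) => //.
  by apply: funext => y; rewrite /mark /= ts.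
rewrite -[RHS]h3; congr o; apply: funext => x; rewrite /sgnop /away /= ltnNge ts /=.
congr (o' _ _); apply: funext => y.
by rewrite /mark /= ltnNge ts.
Qed.

End Inner.
End BlockCircuit.

(** * Amplitude estimation *)

Section AmplitudeEstimation.
Variable R : realType.
Local Notation C := (R[i]).
Local Notation vec T := (T -> C).
Variables (Q : finType) (q0 : Q) (T : finType) (t0 : T).
Variable gs : seq (gate R Q T).
Variable B : vec (Q * T)%type -> vec (Q * T)%type.
Hypothesis uB : uop B B.
Variable d : nat.

Local Notation K := 'I_d.
Local Notation TK := (T * K)%type.

Lemma idK : cancel (@id TK) id. Proof. by []. Qed.

Definition to_K (z : Q * TK) : K * (Q * T) := (z.2.2, (z.1, z.2.1)).
Definition from_K (y : K * (Q * T)) : Q * TK := (y.2.1, (y.2.2, y.1)).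
Lemma to_KK : cancel to_K from_K. Proof. by case=> ? []. Qed.
Lemma from_KK : cancel from_K to_K. Proof. by case=> ? []. Qed.

Variables (prep prepV U UV : vec K -> vec K).
Hypotheses (uprep : uop prep prepV) (uU : uop U UV).

Definition ctl_flip (t : nat) (k : K) := if (t < k)%N then B else id.

Lemma uop_ctl_flip t k : uop (ctl_flip t k) (ctl_flip t k).
Proof. by rewrite /ctl_flip; case: ifP => _ //; apply: uop_id. Qed.

Definition ctl_away (t : nat) (z : Q * TK) :=
  (t < z.2.2)%N && ((z.1, z.2.1) != (q0, t0)).

Definition lifted (hs : seq (gate R Q T)) : seq (gate R Q TK) :=
  map (lift_gate idK idK) hs.

(** On branches with [k <= t] the flip and the signs are inactive and [gs] cancels its inverse, so
    control again needs no controlled query. *)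
Definition outer_round (t : nat) : seq (gate R Q TK) :=
  Free (uop_block (lift_toK idK) (lift_fromK idK) (uop_ctl_flip t)) ::
  lifted (inv_circ gs) ++ Free (uop_sgnop R (ctl_away t)) :: lifted gs.

Definition outer : seq (gate R Q TK) :=
  Free (uop_block to_KK from_KK (fun _ => uprep)) :: lifted gs ++
  flatten [seq outer_round t | t <- iota 0 d] ++
  [:: Free (uop_block to_KK from_KK (fun _ => uU))].

Lemma queries_lifted hs : queries (lifted hs) = queries hs.
Proof. by rewrite /queries count_map; apply: eq_count => -[]. Qed.

Lemma queries_outer : queries outer = (queries gs * (1 + 2 * d))%N.
Proof.
rewrite /outer -cat1s !queries_cat queries_lifted.
rewrite (queries_flatten (c := (2 * queries gs)%N)) ?size_iota.
  by rewrite /queries /=; lia.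
move=> t; rewrite /outer_round -cat1s !queries_cat.
rewrite -[queries (_ :: lifted gs)]/(queries (lifted gs)).
by rewrite !queries_lifted queries_inv /queries /=; lia.
Qed.

Variables (o o' : vec Q -> vec Q).
Hypothesis oo' : uop o o'.
Variable c : nat -> R.
Hypothesis prepE : forall i0 : K, val i0 = 0%N ->
  prep (delta R i0) = fun k => (c k)%:C%C.
Local Notation v := (run o o' gs (delta R (q0, t0))).

Lemma run_outer (i0 : K) : val i0 = 0%N ->
  run o o' outer (delta R (q0, (t0, i0))) =
  fun z => U (fun k => (c k)%:C%C * iter k (grover v B) v (z.1, z.2.1)) z.2.2.
Proof.
move=> i00; rewrite /outer -cat1s !run_cat.
pose sl (w : vec (Q * TK)%type) (k : K) : vec (Q * T)%type := slice (lift_from id) k w.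
pose gl (f : K -> vec (Q * T)%type) : vec (Q * TK)%type := fun z => f z.2.2 (z.1, z.2.1).
have slK f : sl (gl f) = f by apply: funext => k; apply: funext => -[].
have glK w : gl (sl w) = w by apply: funext => -[q [t k]].
have uv := uop_run oo' gs.
have ug : exists G', uop (grover v B) G'.
  by eexists; apply: uop_grover uB; rewrite (uop_nrm2 uv) delta_nrm2.
set v0 := run o o' _ (delta R (q0, (t0, i0))).
have v0E k : sl v0 k = fun z => (c k)%:C%C * delta R (q0, t0) z.
  apply: funext => -[q t]; rewrite /sl /slice /v0 /= /block /lift_from /to_K /=.
  rewrite (_ : slice _ _ _ = fun k => delta R (q0, t0) (q, t) * delta R i0 k); last first.
    apply: funext => k'; rewrite /slice /from_K /delta -!pair_eqE /= ?xpair_eqE.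
    by case: (q == q0); case: (t == t0); case: (k' == i0); rewrite /= ?(mulr0, mulr1).
  by rewrite (uop_scale _ _ uprep) (prepE i00) mulrC.
have v1E k : sl (run o o' (lifted gs) v0) k = fun z => (c k)%:C%C * v z.
  by rewrite /sl run_lift -/(sl v0 k) v0E (uop_scale _ _ uv).
pose round t (f : K -> vec (Q * T)%type) := sl (run o o' (outer_round t) (gl f)).
have runE ts w : run o o' (flatten [seq outer_round t | t <- ts]) w
    = gl (foldl (fun f t => round t f) (sl w) ts).
  elim: ts w => [|t ts IH] w; first by rewrite /= glK.
  by rewrite -[flatten _]/(outer_round t ++ flatten [seq outer_round t | t <- ts])
     run_cat IH [in RHS]/= /round glK.
rewrite runE.
have roundE t f k : round t f k = if (t < k)%N then grover v B (f k) else f k.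
  rewrite /round /outer_round /sl -cat1s !run_cat -cat1s run_cat run_lift.
  set y := run o o' (lifted (inv_circ gs)) _.
  rewrite (_ : slice _ _ _ = if (t < k)%N
     then refl (delta R (q0, t0)) (slice (lift_from id) k y)
     else slice (lift_from id) k y); last first.
    rewrite refl_delta -[run _ _ _ _]/(sgnop (ctl_away t) y).
    apply: funext => -[q s]; rewrite /slice /lift_from /sgnop /ctl_away /=.
    by case: (t < k)%N.
  rewrite /y {y}.
  rewrite run_lift (slice_block (lift_fromK idK)) /ctl_flip.
  rewrite -[slice (lift_from id) k (gl f)]/(sl (gl f) k) slK.
  have [_ _ uvK] := uv; case: (t < k)%N; last exact: uvK.
  exact: refl_conj uv.
rewrite /= /block; apply: funext => z; rewrite /to_K /=.
congr (U _ _); apply: funext => k; rewrite /slice /from_K /gl /=.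
rewrite (@ctl_power R (Q * T)%type K v (fun k => nat_of_ord k)
  (fun _ => grover v B) (fun _ => ug) round (fun k => (c k)%:C%C)) //.
by rewrite (minn_idPl _) // ltnW.
Qed.

End AmplitudeEstimation.

Section AmplitudeEstimationBound.
Variable R : realType.
Local Notation C := (R[i]).
Local Notation vec T := (T -> C).

(** Chebyshev's inequality: since [U] diagonalises the path matrix, the mean square of [lam - x] is
    the squared residual bounded by [qpe_moment]. There are [d = 4 N + 3] rounds, hence the factor
    [1 + 2 d = 8 N + 7]. *)
Lemma amplitude_estimation (Q : finType) (q0 : Q) (T : finType) (t0 : T)
    (gs : seq (gate R Q T)) (B : vec (Q * T)%type -> vec (Q * T)%type) (N : nat) :
  uop B B -> (0 < N)%N ->
  exists (T' : finType) (t' : T') (hs : seq (gate R Q T')) (f : Q * T' -> R),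
    queries hs = (queries gs * (8 * N + 7))%N /\
    forall o o', uop o o' -> forall x,
    let v := run o o' gs (delta R (q0, t0)) in dot v (B v) = x%:C%C ->
    forall a : R, 0 < a ->
    \sum_(z | a < `|f z - x|) sqmod (run o o' hs (delta R (q0, t')) z)
      <= (18 / N%:R ^+ 4 + 64 * (1 - x ^+ 2) / N%:R ^+ 2) / a ^+ 2.
Proof.
move=> uB N0; have [c [[c0 c1 cd cd1] cn S1 S2]] := window_exists R N0.
pose i0 : 'I_(4 * N).+3 := ord0.
have [prep [prepV [uprep prepE]]] := state_prep i0 cn.
have [U [UV [lam [uU UE]]]] := real_symmetric_spectrum (@path_adjC R (4 * N).+3).
exists (T * 'I_(4 * N).+3)%type, (t0, i0), (outer q0 t0 gs uB uprep uU), (fun z => lam z.2.2).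
split; first by rewrite queries_outer; congr (_ * _)%N; lia.
move=> o o' oo' x v vx a a0.
have prepE' (j0 : 'I_(4 * N).+3) : val j0 = 0%N -> prep (delta R j0) = fun k => (c k)%:C%C.
  by move=> h; rewrite -prepE; congr (prep (delta R _)); apply: val_inj.
rewrite (run_outer q0 t0 gs uB uprep uU oo' prepE') // -/v.
have nv : nrm2 v = 1 by rewrite (uop_nrm2 (uop_run oo' gs)) delta_nrm2.
pose w k := iter k (grover v B) v.
have x2 : 0 <= 1 - x ^+ 2.
  have := nrm2_ge0 (fun z => w 2%N z - w 0%N z).
  by rewrite /w (grover_gap nv uB vx 0); lra.
have M := qpe_moment (grover_iter nv uB vx)
  (fun k => etrans (uop_iter_nrm2 k v (uop_grover nv uB)) nv)
  (grover_gap nv uB vx) c0 c1 cd cd1.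
pose psi (z : Q * T) (k : 'I_(4 * N).+3) : C := (c k)%:C%C * w k z.
pose Y (z : Q * (T * 'I_(4 * N).+3)) : C := U (psi (z.1, z.2.1)) z.2.2.
rewrite -[leLHS]/(\sum_(z | a < `|lam z.2.2 - x|) sqmod (Y z)).
rewrite ler_pdivlMr ?exprn_gt0 // mulr_suml.
apply: le_trans (_ : \sum_z (lam z.2.2 - x) ^+ 2 * sqmod (Y z) <= _).
  rewrite big_mkcond; apply: ler_sum => z _; case: ifP => [h|_]; last first.
    by rewrite mulr_ge0 ?sqr_ge0 ?sqmod_ge0.
  rewrite mulrC; apply: ler_wpM2r; first exact: sqmod_ge0.
  by rewrite -[leRHS]real_normK ?num_real //; apply: lerXn2r; rewrite ?nnegrE ?(ltW a0) ?(ltW h).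
apply: le_trans (_ : 2^-1 * (36 / N%:R ^+ 4) + 2 * (1 - x ^+ 2) * (32 / N%:R ^+ 2) <= _); last first.
  by rewrite le_eqVlt; apply/orP; left; apply/eqP; field; rewrite pnatr_eq0 -lt0n.
have h2 : (0 : R) <= 2^-1 by rewrite invr_ge0.
have h1 : 0 <= 2 * (1 - x ^+ 2) by rewrite mulr_ge0.
apply: le_trans (lerD (ler_wpM2l h2 S2) (ler_wpM2l h1 S1)).
apply: le_trans M.
rewrite (sum_slice (@to_KK _ _ _) (@from_KK _ _ _)) /=.
rewrite le_eqVlt; apply/orP; left; apply/eqP; apply: eq_bigr => z _.
rewrite -[RHS](uop_nrm2 uU); apply: eq_bigr => k _ /=.
rewrite /Y /= -sqmodR -sqmodM -surjective_pairing; congr (sqmod _).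
have e1 : ((lam k - x)%:C = (lam k)%:C - x%:C)%C by rewrite rmorphB.
have e2 : ((- x)%:C = - x%:C)%C by rewrite rmorphN.
set A := fun k0 : 'I__ => \sum_j (path_adj R k0 j)%:C%C * psi z j.
rewrite (_ : (fun k0 => _) = fun k0 => 1 * A k0 + (- x)%:C%C * psi z k0); last first.
  by apply: funext => j; rewrite e2 mulNr mul1r.
rewrite (uop_lin uU) (UE (psi z)) e1 e2; ring.
Qed.

End AmplitudeEstimationBound.

(** * Estimating one dyadic block *)

Section DyadicBlock.
Variable R : realType.
Local Notation C := (R[i]).
Local Notation vec T := (T -> C).

Definition entropy_block (n k0 : nat) (p : 'I_n -> R) : R :=
  \sum_(i < k0) (k0 + i)%:R^-1 * \sum_a p a * (1 - p a) ^+ (k0 + i).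

Lemma prob_le1 n (p : 'I_n -> R) : prob_dist p -> forall a, 0 <= p a <= 1.
Proof.
case=> p0 p1 a; rewrite p0 -p1 (bigD1 a) //= lerDl.
by apply: sumr_ge0.
Qed.

Lemma mul_exp_le (y : R) k : 0 <= y <= 1 -> (1 - y) * y ^+ k <= k.+1%:R^-1.
Proof.
move=> /andP[y0 y1]; rewrite -[leRHS]mul1r ler_pdivlMr ?ltr0n //.
(* A form stable under induction: [1 - y ^+ k.+1] is [1 - y] times a geometric sum of [k + 1] terms,
   each at least [y ^+ k]. *)
suff : k.+1%:R * ((1 - y) * y ^+ k) + y ^+ k.+1 <= 1.
  by have := exprn_ge0 k.+1 y0; lra.
elim: k => [|k IH]; first by rewrite expr0 expr1; lra.
have h := ler_wpM2l y0 IH.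
have h0 : 0 <= y ^+ k.+1 by rewrite exprn_ge0.
have h1 : y ^+ k.+1 <= 1 by rewrite exprn_ile1.
have e : k.+2%:R * ((1 - y) * y ^+ k.+1) + y ^+ k.+2 =
   y * (k.+1%:R * ((1 - y) * y ^+ k) + y ^+ k.+1) + (1 - y) * y ^+ k.+1.
  by rewrite -[k.+2%:R]natr1 !exprS; ring.
rewrite e; have : (1 - y) * y ^+ k.+1 <= (1 - y) * 1 by apply: ler_wpM2l => //; lra.
lra.
Qed.

Variables (Q : finType) (q0 : Q) (n : nat) (lab : Q -> 'I_n).
Variables (k0 M t : nat).
Hypotheses (k00 : (0 < k0)%N) (M0 : (0 < M)%N) (kM : (2 * k0 <= M ^ 2)%N).

Local Notation D := (t * M)%N.
Local Notation L := (2 * k0)%N.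
Local Notation S := ('I_k0 * 'I_L)%type.
Local Notation TI := (Q * S)%type.

Definition omega : R := \sum_(i < k0) (k0 + i)%:R^-1.
Definition weight (i : nat) : R := (k0 + i)%:R^-1 / omega.
Definition ampS (s : S) : R :=
  Num.sqrt (weight s.1) * Num.sqrt (binw R (k0 + s.1) s.2).
Definition expS (s : S) : nat := clip (k0 + s.1) D s.2.

Lemma omega_gt0 : 0 < omega.
Proof.
rewrite /omega; case: k0 k00 => // k _; rewrite big_ord_recl.
apply: ltr_pwDl; first by rewrite invr_gt0 ltr0n.
by apply: sumr_ge0 => i _; rewrite invr_ge0.
Qed.

Lemma omega_le1 : omega <= 1.
Proof.
apply: le_trans (_ : \sum_(i < k0) k0%:R^-1 <= _).
  by apply: ler_sum => i _; rewrite lef_pV2 ?posrE ?ltr0n ?addn_gt0 ?k00 // ler_nat leq_addr.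
by rewrite sumr_const card_ord -[leLHS]mulr_natr mulVf // pnatr_eq0 -lt0n.
Qed.

Lemma weight_ge0 i : 0 <= weight i.
Proof. by rewrite divr_ge0 ?invr_ge0 // ltW // omega_gt0. Qed.

Lemma weight_sum : \sum_(i < k0) weight i = 1.
Proof. by rewrite -mulr_suml divff // gt_eqF // omega_gt0. Qed.

Lemma ltL (i : 'I_k0) : (k0 + i < L)%N.
Proof. by rewrite mul2n -addnn ltn_add2l. Qed.

Lemma ampS_sum : \sum_s ampS s ^+ 2 = 1.
Proof.
rewrite -weight_sum -(pair_big xpredT xpredT (fun i j => ampS (i, j) ^+ 2)) /=.
apply: eq_bigr => i _.
rewrite -[RHS]mulr1 -(binw_sum R (ltL i)) mulr_sumr; apply: eq_bigr => l _.
by rewrite /ampS /= exprMn !sqr_sqrtr ?weight_ge0 ?binw_ge0.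
Qed.

Definition to_L (z : Q * TI) : 'I_L * (Q * Q * 'I_k0) :=
  (z.2.2.2, ((z.1, z.2.1), z.2.2.1)).
Definition from_L (y : 'I_L * (Q * Q * 'I_k0)) : Q * TI :=
  (y.2.1.1, (y.2.1.2, (y.2.2, y.1))).
Lemma to_LK : cancel to_L from_L. Proof. by case=> ? [? []]. Qed.
Lemma from_LK : cancel from_L to_L. Proof. by case=> ? [[? ?] ?]. Qed.

Definition binvec (i : nat) : vec 'I_L :=
  fun l => (Num.sqrt (binw R (k0 + i) l))%:C%C.

Lemma binvec_nrm2 (i : 'I_k0) : nrm2 (binvec i) = 1.
Proof.
rewrite -(binw_sum R (ltL i)); apply: eq_bigr => l _.
by rewrite sqmodR sqr_sqrtr ?binw_ge0.
Qed.

(** Linear combination of unitaries: the preparation puts the root of [binw] on [l], and the overlap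
    with [binvec] supplies the same root again, restoring the weight [binw]. Flipping the sign of
    this projection has expectation [1 - 2 q], with [q] the success probability. *)
Definition flag : vec (Q * TI)%type -> vec (Q * TI)%type :=
  block to_L from_L (fun r => nrefl (binvec r.2)).

Lemma uop_flag : uop flag flag.
Proof.
apply: (uop_block to_LK from_LK) => r; apply: uop_nrefl; exact: binvec_nrm2.
Qed.

Lemma dot_flag v : nrm2 v = 1 -> dot v (flag v) =
  (1 - 2 * \sum_(r : Q * Q * 'I_k0) sqmod (dot (binvec r.2) (slice from_L r v)))%:C%C.
Proof.
move=> nv; rewrite (dot_slice to_LK from_LK).
under eq_bigr => r _ do rewrite (slice_block from_LK) dot_nrefl.
rewrite -rmorph_sum sumrB mulr_sumr -nv (nrm2_slice to_LK from_LK).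
by [].
Qed.

Section Oracle.
Variables (p : 'I_n -> R) (o o' : vec Q -> vec Q).
Hypotheses (pp : prob_dist p) (so : samples q0 lab p o o').
Local Notation u := (o (delta R q0)).
Let oo' : uop o o'. Proof. by case: so. Qed.

Lemma samples_sum (g : 'I_n -> R) : \sum_d sqmod (u d) * g (lab d) = \sum_a p a * g a.
Proof.
rewrite (partition_big lab xpredT) //=; apply: eq_bigr => a _.
rewrite -(so.2 a) mulr_suml; apply: eq_bigr => d /eqP <-.
by [].
Qed.

Lemma dot_sample a : dot u (sgnop (fun q => lab q == a) u) = (1 - 2 * p a)%:C%C.
Proof.
have -> : 1 - 2 * p a = nrm2 u - 2 * p a by rewrite (oracle_nrm2 q0 oo').
rewrite -(so.2 a) mulr_sumr [X in nrm2 _ - X]big_mkcond /=.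
rewrite -sumrB rmorph_sum; apply: eq_bigr => q _ /=; rewrite /sgnop.
case: ifP => _; last by rewrite subr0 sqmodE.
have -> : sqmod (u q) - 2 * sqmod (u q) = - sqmod (u q) by ring.
by rewrite rmorphN /= sqmodE mulrN.
Qed.

Definition lcu_prob : R := \sum_d sqmod (u d) * \sum_(i < k0) weight i *
  nrm2 (lcu u (sgnop (fun q => lab q == lab d)) L (k0 + i) D).

Lemma lcu_probE : \sum_(r : Q * Q * 'I_k0) sqmod (dot (binvec r.2) (slice from_L r (fun z : Q * TI =>
    ((ampS z.2.2)%:C%C * u z.2.1) * iter (expS z.2.2) (sampleG q0 lab o (lab z.2.1)) u z.1)))
  = lcu_prob.
Proof.
rewrite -(pair_big xpredT xpredT (fun (qd : Q * Q) (i : 'I_k0) => sqmod (dot (binvec i)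
  (slice from_L (qd, i) (fun z : Q * TI => ((ampS z.2.2)%:C%C * u z.2.1)
    * iter (expS z.2.2) (sampleG q0 lab o (lab z.2.1)) u z.1))))) /=.
rewrite -(pair_big xpredT xpredT (fun q d : Q => \sum_(i < k0) sqmod (dot (binvec i)
  (slice from_L ((q, d), i) (fun z : Q * TI => ((ampS z.2.2)%:C%C * u z.2.1)
    * iter (expS z.2.2) (sampleG q0 lab o (lab z.2.1)) u z.1))))) /=.
rewrite exchange_big /=; apply: eq_bigr => d _.
rewrite exchange_big /= mulr_sumr; apply: eq_bigr => i _.
rewrite /nrm2 !mulr_sumr; apply: eq_bigr => q _.
rewrite -[weight i]sqr_sqrtr ?weight_ge0 // -sqmodR -!sqmodM; congr (sqmod _).
rewrite /dot /lcu !mulr_sumr; apply: eq_bigr => l _.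
rewrite /binvec conjc_real /slice /from_L /ampS /expS /sampleG /=.
rewrite -[binw R (k0 + i) l in RHS]sqr_sqrtr ?binw_ge0 // expr2 !rmorphM /=; ring.
Qed.

Variable eta : R.
Hypothesis eta0 : 0 < eta.
Local Notation ep := (eta + (1 + eta^-1) * (16 / 4 ^+ t)).

Lemma lcu_prob_approx :
  `|lcu_prob - \sum_(i < k0) weight i * \sum_a p a * (1 - p a) ^+ (k0 + i)| <= ep.
Proof.
have -> : \sum_(i < k0) weight i * \sum_a p a * (1 - p a) ^+ (k0 + i)
   = \sum_d sqmod (u d) * \sum_(i < k0) weight i * (1 - p (lab d)) ^+ (k0 + i).
  rewrite (samples_sum (fun a => \sum_(i < k0) weight i * (1 - p a) ^+ (k0 + i))).
  under eq_bigr do rewrite mulr_sumr; rewrite exchange_big; apply: eq_bigr => a _ /=.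
  by rewrite mulr_sumr; apply: eq_bigr => i _; ring.
rewrite -sumrB; apply: le_trans (ler_norm_sum _ _ _) _.
have ep1 : ep = \sum_d sqmod (u d) * (\sum_(i < k0) weight i * ep).
  have e1 : \sum_(i < k0) weight i * ep = ep by rewrite -mulr_suml weight_sum mul1r.
  by rewrite e1 -mulr_suml -/(nrm2 _) (oracle_nrm2 q0 oo') mul1r.
rewrite ep1; apply: ler_sum => d _.
rewrite -mulrBr normrM ger0_norm ?sqmod_ge0 //.
apply: ler_wpM2l; first exact: sqmod_ge0.
rewrite -sumrB; apply: le_trans (ler_norm_sum _ _ _) _.
apply: ler_sum => i _; rewrite -mulrBr normrM ger0_norm ?weight_ge0 //.
apply: ler_wpM2l; first exact: weight_ge0.
have /andP[p0 p1] := prob_le1 pp (lab d).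
have -> : 1 - p (lab d) = (1 + (1 - 2 * p (lab d))) / 2 by field.
apply: (lcu_approx (oracle_nrm2 q0 oo') (uop_sgnop _ _) (dot_sample _)) => //.
- lra.
- lra.
- exact: ltL.
- by apply: leq_trans kM; apply: ltnW; apply: ltL.
Qed.

Lemma block_prob_le :
  \sum_(i < k0) weight i * \sum_a p a * (1 - p a) ^+ (k0 + i) <= n%:R / k0%:R.
Proof.
have -> : n%:R / k0%:R = \sum_(i < k0) weight i * (n%:R / k0%:R).
  by rewrite -mulr_suml weight_sum mul1r.
apply: ler_sum => i _.
apply: ler_wpM2l; first exact: weight_ge0.
apply: le_trans (_ : \sum_(a < n) k0%:R^-1 <= _); last first.
  by rewrite sumr_const card_ord -[leLHS]mulr_natl.
apply: ler_sum => a _; have /andP[p0 p1] := prob_le1 pp a.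
have h : 0 <= 1 - p a <= 1 by apply/andP; split; lra.
have := mul_exp_le (k0 + i) h; rewrite opprB addrC subrK => h1.
apply: le_trans h1 _; rewrite lef_pV2 ?posrE ?ltr0n //.
by rewrite ler_nat leqW // leq_addr.
Qed.

End Oracle.

Lemma estimable_block N (eta e : R) : (0 < N)%N -> 0 < eta -> 0 < e ->
  let ep := eta + (1 + eta^-1) * (16 / 4 ^+ t) in
  estimable q0 lab ((4 * D + 4) * (8 * N + 7)) (@entropy_block n k0) (e + ep)
    ((18 / N%:R ^+ 4 + 256 * (n%:R / k0%:R + ep) / N%:R ^+ 2) / (4 * e ^+ 2)).
Proof.
move=> N0 eta0 e0 ep.
have i0 : 'I_k0 by case: k0 k00 => // k _; apply: ord0.
have l0 : 'I_L by exact: (Ordinal (ltL i0)).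
have [prep [prepV [uprep prepE]]] := state_prep (i0, l0) ampS_sum.
have eE s : (expS s <= (2 * D).+1)%N by apply: clip_le.
pose gs := inner q0 lab expS (2 * D).+1 uprep.
have [T [t' [hs [f [qs hE]]]]] := amplitude_estimation q0 (q0, (i0, l0)) gs uop_flag N0.
exists T, t', hs, (fun z => omega * (1 - f z) / 2); split.
  by rewrite qs queries_inner leq_mul2r; apply/orP; right; lia.
move=> p pp o o' so; have [oo' _] := so.
set pr := lcu_prob o.
have nv : nrm2 (run o o' gs (delta R (q0, (q0, (i0, l0))))) = 1.
  by rewrite (uop_nrm2 (uop_run oo' gs)) delta_nrm2.
have := dot_flag nv.
rewrite [in X in _ = X](run_inner q0 lab eE uprep prepE oo') lcu_probE -/pr => vx.
set Tq := \sum_(i < k0) weight i * \sum_a p a * (1 - p a) ^+ (k0 + i).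
have TE : entropy_block k0 p = omega * Tq.
  rewrite /entropy_block mulr_sumr; apply: eq_bigr => i _.
  by rewrite mulrA; congr (_ * _); rewrite /weight mulrC divfK // gt_eqF // omega_gt0.
have prT : `|pr - Tq| <= ep := lcu_prob_approx pp so eta0.
have Tn : Tq <= n%:R / k0%:R := block_prob_le pp.
have pr0 : 0 <= pr.
  apply: sumr_ge0 => d _; rewrite mulr_ge0 ?sqmod_ge0 //; apply: sumr_ge0 => i _.
  by rewrite mulr_ge0 ?weight_ge0 ?nrm2_ge0.
have prn : pr <= n%:R / k0%:R + ep.
  by move: prT; rewrite ler_norml => /andP[_]; lra.
have e2 : 0 < 2 * e by rewrite mulr_gt0.
have om0 := omega_gt0; have om1 := omega_le1.
(* Passing from the reading to [(1 - f z) / 2] halves the error, and [omega <= 1] does not enlarge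
   it. *)
apply: le_trans (_ : \sum_(z | 2 * e < `|f z - (1 - 2 * pr)|)
    sqmod (run o o' hs (delta R (q0, t')) z) <= _).
  rewrite big_mkcond [leRHS]big_mkcond /=; apply: ler_sum => z _.
  case: ifP => [h1|_]; last by case: ifP => // _; apply: sqmod_ge0.
  rewrite ifT // ltNge; apply/negP => h2; move: h1; rewrite ltNge => /negP; apply.
  have -> : omega * (1 - f z) / 2 - entropy_block k0 p =
     omega * (- ((f z - (1 - 2 * pr)) / 2) + (pr - Tq)) by rewrite TE; field.
  rewrite normrM (gtr0_norm om0) -[leRHS]mul1r.
  apply: ler_pM => //; first exact: ltW.
  apply: le_trans (ler_normD _ _) _; apply: lerD => //.
  rewrite normrN normrM [`|2^-1|]gtr0_norm ?invr_gt0 //; lra.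
apply: le_trans (hE o o' oo' _ vx _ e2) _.
have -> : (2 * e) ^+ 2 = 4 * e ^+ 2 by ring.
apply: ler_wpM2r; first by rewrite invr_ge0 mulr_ge0 ?sqr_ge0.
(* [256 = 64 * 4]: for [x = 1 - 2 pr] one has [1 - x ^+ 2 = 4 pr (1 - pr) <= 4 pr]. *)
rewrite lerD2l; apply: ler_wpM2r; first by rewrite invr_ge0 sqr_ge0.
have := sqr_ge0 pr; rewrite expr2; nra.
Qed.

End DyadicBlock.

(** * Truncating the entropy series *)

Section LogSeries.
Variable R : realType.

Definition ln_remainder (N : nat) (x : R) : R :=
  - ln x - \sum_(k < N) k.+1%:R^-1 * (1 - x) ^+ k.+1.

Lemma is_derive_ln_remainder N (x : R) : 0 < x ->
  is_derive x 1 (ln_remainder N) (- ((1 - x) ^+ N / x)).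
Proof.
move=> x0.
have -> : ln_remainder N = - (@ln R) - \sum_(k < N)
    k.+1%:R^-1 \*: ((cst 1 - id : R -> R) ^+ k.+1).
  apply: funext => y; rewrite /ln_remainder !fctE fct_sumE; congr (_ - _).
  by apply: eq_bigr => k _; rewrite !fctE.
have d := is_derive1_ln x0.
apply: is_derive_eq.
have x1 : x != 0 by rewrite gt_eqF.
rewrite (eq_bigr (fun k : 'I_N => - (1 - x) ^+ k)); last first.
  move=> k _; rewrite /GRing.scale /= !fctE /=.
  by rewrite sub0r mulrN1 mulrN mulrA mulVf ?mul1r ?pnatr_eq0.
rewrite sumrN opprK; have := subrX1 (1 - x) N.
have -> : 1 - x - 1 = - x by ring.
move=> e; have -> : \sum_(i < N) (1 - x) ^+ i = (1 - (1 - x) ^+ N) / x.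
  by apply: (mulfI x1); rewrite mulrC [RHS]mulrC divfK //; lra.
by field.
Qed.

Lemma ln_remainder1 N : ln_remainder N 1 = 0.
Proof.
rewrite /ln_remainder ln1 oppr0 big1 ?subr0 // => k _.
by rewrite subrr expr0n mulr0.
Qed.

(** The remainder vanishes at 1 and decreases on []0, 1]]. Its difference to [(N.+1%:R * y)^-1] is
    monotone as well, because [y (1 - y) ^+ N <= 1/(N + 1)]. The factor [1/p] later cancels against
    the [p] in the entropy, so small probabilities do no harm. *)
Lemma ln_remainder_bound N (p : R) : 0 < p <= 1 ->
  0 <= ln_remainder N p <= (N.+1%:R * p)^-1.
Proof.
move=> /andP[p0 p1].
have pos (y : R) : y \in `[p, 1] -> 0 < y <= 1.
  by rewrite in_itv /= => /andP[py ->]; rewrite (lt_le_trans p0 py).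
have poso (y : R) : y \in `]p, 1[ -> 0 < y <= 1.
  by rewrite in_itv /= => /andP[py /ltW ->]; rewrite (lt_trans p0 py).
have dR (y : R) : 0 < y -> is_derive y 1 (ln_remainder N) (- ((1 - y) ^+ N / y)).
  exact: is_derive_ln_remainder.
apply/andP; split.
  have [] := @MVT_segment R (ln_remainder N) (fun y => - ((1 - y) ^+ N / y)) p 1 p1.
  - by move=> y /poso/andP[y0 _]; apply: dR.
  - by apply: derivable_within_continuous => y /pos/andP[y0 _]; have := dR y y0.
  move=> c /pos/andP[c0 c1]; rewrite ln_remainder1 sub0r => /eqP.
  rewrite eqr_oppLR mulNr opprK => /eqP ->.
  by rewrite mulr_ge0 ?divr_ge0 ?exprn_ge0 ?subr_ge0 // ltW.
pose g : R -> R := fun y => N.+1%:R^-1 * y^-1 - ln_remainder N y.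
have dg (y : R) : 0 < y -> is_derive y 1 g (- (N.+1%:R^-1 / y ^+ 2) + (1 - y) ^+ N / y).
  move=> y0; have d1 := dR y y0.
  have y1 : y != 0 by rewrite gt_eqF.
  have d2 := @is_deriveV R id y 1 1 y1 (is_derive_id _ _).
  have -> : g = N.+1%:R^-1 \*: (fun z : R => (id z)^-1) - ln_remainder N.
    by apply: funext => z; rewrite !fctE.
  apply: is_derive_eq; rewrite /GRing.scale /= opprK mulr1 mulrN.
  by [].
have [] := @MVT_segment R g (fun y => - (N.+1%:R^-1 / y ^+ 2) + (1 - y) ^+ N / y) p 1 p1.
- by move=> y /poso/andP[y0 _]; apply: dg.
- by apply: derivable_within_continuous => y /pos/andP[y0 _]; have := dg y y0.
move=> c /pos/andP[c0 c1]; rewrite /g ln_remainder1 subr0 invr1 mulr1 => e.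
have h : - (N.+1%:R^-1 / c ^+ 2) + (1 - c) ^+ N / c <= 0.
  have -> : - (N.+1%:R^-1 / c ^+ 2) + (1 - c) ^+ N / c =
     ((1 - (1 - c)) * (1 - c) ^+ N - N.+1%:R^-1) / c ^+ 2.
    by field; rewrite gt_eqF //= addrC natr1 pnatr_eq0.
  rewrite mulr_le0_ge0 ?invr_ge0 ?sqr_ge0 // subr_le0.
  by apply: mul_exp_le; apply/andP; split; lra.
have N0 : 0 <= N.+1%:R^-1 :> R by rewrite invr_ge0.
have := mulr_le0_ge0 h (_ : 0 <= 1 - p); rewrite subr_ge0 => /(_ p1).
rewrite -e invfM; move: (N.+1%:R^-1 / p) => s; move: N.+1%:R^-1 N0 => z z0.
move: (ln_remainder N p) => r; clear -z0; lra.
Qed.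

Lemma sum_entropy_block n J (p : 'I_n -> R) :
  \sum_(j < J) entropy_block (2 ^ j) p =
  \sum_a p a * \sum_(k < (2 ^ J).-1) k.+1%:R^-1 * (1 - p a) ^+ k.+1.
Proof.
pose g k := k%:R^-1 * \sum_a p a * (1 - p a) ^+ k.
transitivity (\sum_(1 <= k < 2 ^ J) g k).
  elim: J => [|J IH]; first by rewrite big_ord0 big_geq.
  rewrite big_ord_recr /= IH [RHS](big_cat_nat (n := 2 ^ J)) ?expn_gt0 ?leq_exp2l //=.
  congr (_ + _); rewrite /entropy_block -[in RHS](add0n (2 ^ J)%N) big_addn.
  rewrite expnS mul2n -addnn addnK big_mkord.
  by apply: eq_bigr => i _; rewrite /g addnC.
rewrite big_add1 big_mkord /g; under eq_bigr do rewrite mulr_sumr.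
rewrite exchange_big; apply: eq_bigr => a _ /=; rewrite mulr_sumr.
by apply: eq_bigr => k _; ring.
Qed.

Lemma entropy_truncation n J (p : 'I_n -> R) : prob_dist p ->
  `|\sum_(j < J) entropy_block (2 ^ j) p - shannon_entropy p| <= n%:R / 2 ^+ J.
Proof.
move=> pp; rewrite sum_entropy_block distrC /shannon_entropy -sumrN -sumrB.
have N1 : ((2 ^ J).-1.+1 = 2 ^ J)%N by rewrite prednK // expn_gt0.
apply: le_trans (ler_norm_sum _ _ _) _.
apply: le_trans (_ : \sum_(a < n) (2 ^+ J)^-1 <= _); last first.
  by rewrite sumr_const card_ord -[leLHS]mulr_natl.
apply: ler_sum => a _; have /andP[p0 p1] := prob_le1 pp a.
have -> : - (p a * ln (p a)) - p a * (\sum_(k < (2 ^ J).-1) k.+1%:R^-1 * (1 - p a) ^+ k.+1)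
  = p a * ln_remainder (2 ^ J).-1 (p a) by rewrite /ln_remainder; ring.
have [->|pn0] := eqVneq (p a) 0.
  by rewrite mul0r normr0 invr_ge0 exprn_ge0.
have p0' : 0 < p a by rewrite lt_neqAle eq_sym pn0.
have /andP[r0 r1] : 0 <= ln_remainder (2 ^ J).-1 (p a) <= ((2 ^ J).-1.+1%:R * p a)^-1.
  by apply: ln_remainder_bound; rewrite p0'.
rewrite ger0_norm ?mulr_ge0 //; apply: le_trans (ler_wpM2l p0 r1) _.
by rewrite N1 natrX invfM mulrC divfK.
Qed.

Lemma entropy_ge0 n (p : 'I_n -> R) : prob_dist p -> 0 <= shannon_entropy p.
Proof.
move=> pp; rewrite /shannon_entropy oppr_ge0; apply: sumr_le0 => a _.
have /andP[p0 p1] := prob_le1 pp a.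
by apply: mulr_ge0_le0 => //; apply: ln_le0.
Qed.

(** Gibbs' inequality against the uniform distribution: [ln (1 + y) <= y] at [y = 1/(n p) - 1]
    leaves corrections [1/n - p] that sum to zero. *)
Lemma entropy_le_ln n (p : 'I_n -> R) : (0 < n)%N -> prob_dist p ->
  shannon_entropy p <= ln n%:R.
Proof.
move=> n0 pp; have n0' : 0 < n%:R :> R by rewrite ltr0n.
have h a : - (p a * ln (p a)) <= p a * ln n%:R + (n%:R^-1 - p a).
  have /andP[p0 p1] := prob_le1 pp a; have [->|pn0] := eqVneq (p a) 0.
    by rewrite !mul0r !oppr0 add0r addr0 invr_ge0 ltW.
  have p0' : 0 < p a by rewrite lt_neqAle eq_sym pn0.
  have np : 0 < (n%:R * p a)^-1 by rewrite invr_gt0 mulr_gt0.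
  have := @le_ln1Dx R ((n%:R * p a)^-1 - 1); rewrite [1 + _]addrC subrK.
  have -> : -1 < (n%:R * p a)^-1 - 1 by lra.
  rewrite lnV ?posrE ?mulr_gt0 // lnM ?posrE // => /(_ isT) /(ler_wpM2l p0).
  have -> : p a * ((n%:R * p a)^-1 - 1) = n%:R^-1 - p a.
    by field; rewrite pn0 gt_eqF.
  lra.
rewrite /shannon_entropy -sumrN; apply: le_trans (ler_sum _ (fun a _ => h a)) _.
rewrite big_split sumrB -mulr_suml /= pp.2 mul1r sumr_const card_ord.
have -> : n%:R^-1 *+ n = 1 :> R by rewrite -[LHS]mulr_natr mulVf // gt_eqF.
by rewrite subrr addr0.
Qed.

End LogSeries.

(** * Choice of parameters *)

Section Tuning.
Variable R : realType.

Lemma ler_of_sqr (x y : R) : 0 <= y -> x ^+ 2 <= y ^+ 2 -> x <= y.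
Proof. by move=> y0 h; rewrite leNgt; apply/negP => yx; nra. Qed.

(** With [eta = e / 2] and [4 ^+ t >= 100 / e ^+ 2], the second term is at most
    [16/100 (e ^+ 2 + 2 e) <= 48/100 e], within the remaining half. *)
Lemma clip_error_le (e : R) t : 0 < e <= 1 -> 10 / e <= 2 ^+ t ->
  e / 2 + (1 + (e / 2)^-1) * (16 / 4 ^+ t) <= e.
Proof.
move=> /andP[e0 e1] h; have en : e != 0 by rewrite gt_eqF.
have i0 : 0 < e^-1 by rewrite invr_gt0.
have i1 : 1 <= e^-1 by rewrite invf_ge1.
have h4 : 100 * e ^- 2 <= 4 ^+ t.
  have -> : (4 : R) = 2 ^+ 2 by rewrite expr2; ring.
  rewrite -exprM mulnC exprM -exprVn.
  have -> : 100 * e^-1 ^+ 2 = (10 / e) ^+ 2 by ring.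
  by apply: lerXn2r; rewrite ?nnegrE ?exprn_ge0 ?mulr_ge0 ?(ltW i0).
have p4 : 0 < 4 ^+ t :> R by rewrite exprn_gt0.
have h5 : 16 / 4 ^+ t <= 16 * e ^+ 2 / 100.
  rewrite ler_pdivrMr //; apply: le_trans (_ : 16 * e ^+ 2 / 100 * (100 * e ^- 2) <= _).
    by rewrite le_eqVlt; apply/orP; left; apply/eqP; field.
  by apply: ler_wpM2l h4; rewrite divr_ge0 // mulr_ge0 // sqr_ge0.
have h6 : 0 <= 1 + (e / 2)^-1 by rewrite addr_ge0 // invr_ge0 divr_ge0 // ltW.
have := ler_wpM2l h6 h5.
have -> : (1 + (e / 2)^-1) * (16 * e ^+ 2 / 100) = 16 / 100 * (e ^+ 2 + 2 * e) by field.
have : e ^+ 2 <= e by rewrite expr2; nra.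
lra.
Qed.

Lemma count_le (a N : nat) : (0 < a)%N -> (0 < N)%N ->
  ((4 * a + 4) * (8 * N + 7))%N%:R <= 120 * (a%:R * N%:R) :> R.
Proof.
move=> a0 N0; have a1 : 1 <= a%:R :> R by rewrite ler1n.
have N1 : 1 <= N%:R :> R by rewrite ler1n.
by rewrite natrM (natrD _ (4 * a)%N) (natrD _ (8 * N)%N) (natrM _ 4) (natrM _ 8); nra.
Qed.

Variables (Q : finType) (q0 : Q) (n : nat) (lab : Q -> 'I_n).

Lemma estimable_block_cost (e : R) (J t j : nat) : (0 < n)%N -> (0 < J)%N ->
  0 < e <= 1 -> 10 / e <= 2 ^+ t -> 2 ^+ j <= n%:R / e ->
  exists N : nat, N%:R <= 120 * 192 * t%:R * J%:R * (Num.sqrt n%:R / e) /\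
    estimable q0 lab N (@entropy_block R n (2 ^ j)) (2 * e) (3 * J%:R)^-1.
Proof.
move=> n0 J0 e01 te je; have /andP[e0 e1] := e01.
have en : e != 0 by rewrite gt_eqF.
set k0 := (2 ^ j)%N; have k00 : (0 < k0)%N by rewrite expn_gt0.
(* An integer stand-in for [sqrt k0]: [2 k0 <= M ^ 2 <= 4 k0] for either parity of [j]. *)
pose M := (2 ^ (j./2).+1)%N.
have M0 : (0 < M)%N by rewrite expn_gt0.
have kM : (2 * k0 <= M ^ 2)%N.
  by rewrite /k0 /M -expnS -expnM leq_exp2l //; lia.
have Mk : (M ^ 2 <= 4 * k0)%N.
  by rewrite /k0 /M -expnM (_ : 4 = 2 ^ 2)%N // -expnD leq_exp2l //; lia.
have t0 : (0 < t)%N.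
  case: t te => // h; exfalso; move: h; rewrite expr0 leNgt => /negP; apply.
  by rewrite ltr_pdivlMr //; lra.
pose se := Num.sqrt e; pose sn := Num.sqrt (n%:R : R); pose sk := Num.sqrt (k0%:R : R).
have se0 : 0 < se by rewrite sqrtr_gt0.
have sn0 : 0 < sn by rewrite sqrtr_gt0 ltr0n.
have sk0 : 0 < sk by rewrite sqrtr_gt0 ltr0n.
have se2 : se ^+ 2 = e by rewrite sqr_sqrtr // ltW.
have sn2 : sn ^+ 2 = n%:R by rewrite sqr_sqrtr.
have sk2 : sk ^+ 2 = k0%:R by rewrite sqr_sqrtr.
have Jr : 1 <= J%:R :> R by rewrite ler1n.
(* For [N >= X], the sum of [1/(N^2 e)] and [n/(N^2 k0 e^2)] is at most [1/(576 J^2)], where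
   [576 = 24^2]. The Chebyshev terms then total at most [(9/2 + 64)/(576 J)], below [1/(3 J)]. *)
pose X := 24 * J%:R * (se^-1 + sn / (sk * e)).
have ie : 1 <= se^-1.
  by rewrite invf_ge1 //; apply: ler_of_sqr => //; rewrite se2 expr1n.
have q1 : 0 <= sn / (sk * e) by rewrite divr_ge0 ?mulr_ge0 ?ltW.
have X1 : 1 <= X by rewrite /X; nra.
have X0 : 0 <= X by lra.
pose N := (Num.truncn X).+1.
have /andP[NX XN] := truncn_itv X0.
have XN' : X <= N%:R by rewrite ltW.
have NX' : N%:R <= 2 * X by rewrite /N -natr1; lra.
have N0 : 0 < (N%:R : R) by lra.
pose W := (N%:R ^+ 2 : R)^-1.
have W0 : 0 < W by rewrite invr_gt0 exprn_gt0.
have WX : W * (e^-1 + n%:R / (k0%:R * e ^+ 2)) <= (576 * J%:R ^+ 2)^-1.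
  rewrite -[leRHS]mulr1 [leRHS]mulrC ler_pdivlMr; last first.
    by rewrite mulr_gt0 ?exprn_gt0 //; lra.
  rewrite -mulrA /W mulrC ler_pdivrMr ?exprn_gt0 // mul1r.
  apply: le_trans (_ : X ^+ 2 <= _); last by apply: lerXn2r; rewrite ?nnegrE ?(ltW N0).
  have -> : (e^-1 + n%:R / (k0%:R * e ^+ 2)) * (576 * J%:R ^+ 2) =
     (24 * J%:R) ^+ 2 * (se^-1 ^+ 2 + (sn / (sk * e)) ^+ 2).
    by rewrite -se2 -sn2 -sk2; field; rewrite !gt_eqF.
  rewrite /X [leRHS]exprMn; apply: ler_wpM2l; first exact: sqr_ge0.
  have : 0 <= se^-1 * (sn / (sk * e)) by rewrite mulr_ge0 // invr_ge0 ltW.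
  rewrite sqrrD -mulr_natr; lra.
exists ((4 * (t * M) + 4) * (8 * N + 7))%N; split.
  have tM0 : (0 < t * M)%N by rewrite muln_gt0 t0.
  apply: le_trans (count_le tM0 (ltn0Sn _)) _; rewrite -/N [(t * M)%:R]natrM.
  have Msk : M%:R <= 2 * sk.
    apply: ler_of_sqr; first by rewrite mulr_ge0 // ltW.
    rewrite exprMn sk2 -natrX.
    by rewrite (_ : 2 ^+ 2 * k0%:R = (4 * k0)%:R) ?ler_nat // natrM -natrX.
  (* The bound [2 ^+ j <= n%:R / e] enters here: the [1/sqrt e] part of [X], multiplied by
     [sqrt k0], costs no more than the main part. *)
  have skn : sk <= sn / se.
    apply: ler_of_sqr; first by rewrite divr_ge0 // ltW.
    rewrite exprMn exprVn sk2 sn2 se2.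
    by rewrite /k0 natrX.
  have MN : M%:R * N%:R <= 192 * J%:R * (sn / e).
    apply: le_trans (ler_pM _ _ Msk NX') _ => //.
    have -> : 2 * sk * (2 * X) = 96 * J%:R * (sk / se + sn / e).
      by rewrite /X; field; rewrite !gt_eqF.
    have : sk / se <= sn / e.
      have -> : sn / e = sn / se / se by rewrite -se2; field; rewrite gt_eqF.
      by rewrite ler_pM2r // invr_gt0.
    have J96 : 0 <= 96 * J%:R :> R by lra.
    move=> h; have := ler_wpM2l J96 h.
    by move: (sn / e) (sk / se) (J%:R) => y1 y2 y3; lra.
  have t120 : 0 <= 120 * t%:R :> R by rewrite mulr_ge0.
  have := ler_wpM2l t120 MN; rewrite -/sn.
  by move: (sn / e) (M%:R) (N%:R) (t%:R) (J%:R) => y1 y2 y3 y4 y5; lra.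
have e20 : 0 < e / 2 by lra.
have := @estimable_block R Q q0 n lab k0 M t k00 M0 kM N (e / 2) e isT e20 e0.
set ep := e / 2 + _; have epe : ep <= e := clip_error_le e01 te.
move=> h; have -> : 2 * e = (e + ep) + (e - ep) by ring.
apply: (estimable_shift (tau := @entropy_block R n k0)).
  by move=> p _; rewrite subrr normr0 subr_ge0.
apply: (estimable_weaken (leqnn _) _ h).
apply: le_trans (_ : 9 / 2 * (W * e^-1) ^+ 2 + 64 * (W * (e^-1 + n%:R / (k0%:R * e ^+ 2))) <= _).
  have -> : (18 / N%:R ^+ 4 + 256 * (n%:R / k0%:R + ep) / N%:R ^+ 2) / (4 * e ^+ 2) =
     9 / 2 * (W * e^-1) ^+ 2 + 64 * (W * (ep / e ^+ 2 + n%:R / (k0%:R * e ^+ 2))).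
    by rewrite /W; field; rewrite en !gt_eqF ?ltr0n.
  rewrite lerD2l; apply: ler_wpM2l => //; apply: ler_wpM2l; first exact: ltW.
  rewrite lerD2r ler_pdivrMr ?exprn_gt0 // expr2 mulrA mulVf // mul1r.
  by [].
have i0 : 0 < e^-1 by rewrite invr_gt0.
have We : W * e^-1 <= (576 * J%:R ^+ 2)^-1.
  apply: le_trans WX; apply: ler_wpM2l; first exact: ltW.
  by rewrite lerDl divr_ge0 // mulr_ge0 // sqr_ge0.
have iJ : (576 * J%:R ^+ 2)^-1 <= 576^-1 / J%:R :> R.
  rewrite invfM; apply: ler_wpM2l; first by rewrite invr_ge0.
  by rewrite lef_pV2 ?posrE ?exprn_gt0 ?(lt_le_trans ltr01 Jr) // expr2 ler_peMl.
have iJ1 : J%:R^-1 <= 1 :> R by rewrite invf_le1 // (lt_le_trans ltr01 Jr).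
have iJ0 : 0 < J%:R^-1 :> R by rewrite invr_gt0 (lt_le_trans ltr01 Jr).
have -> : (3 * J%:R)^-1 = 3^-1 * J%:R^-1 :> R by rewrite invfM.
have We0 : 0 <= W * e^-1 by rewrite mulr_ge0 // ltW.
have : (W * e^-1) ^+ 2 <= (576^-1 / J%:R) * 1.
  by rewrite expr2; apply: ler_pM => //; [apply: le_trans We iJ | lra].
lra.
Qed.

Lemma ln2_ge : 2^-1 <= ln 2 :> R.
Proof.
have := @le_ln1Dx R (- 2^-1); have -> : 1 + - 2^-1 = 2^-1 :> R by field.
by rewrite lnV ?posrE // => /(_ _); lra.
Qed.

Lemma pow2_ceil (x : R) : 1 <= x ->
  exists k : nat, [/\ x <= 2 ^+ k, 2 ^+ k <= 2 * x & k%:R <= 1 + 2 * ln x].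
Proof.
move=> x1; have x0 : 0 <= x by lra.
have ex : exists k : nat, x <= 2 ^+ k.
  exists (Num.truncn x).+1; have /andP[_ h] := truncn_itv x0.
  apply: le_trans (ltW h) _; rewrite -natrX ler_nat ltnW // ltn_expl //.
have lx : 0 <= ln x by apply: ln_ge0.
case: (ex_minnP ex) => -[|k] xk kmin.
  by exists 0%N; split=> //; lra.
have h : 2 ^+ k < x by rewrite ltNge; apply/negP => /kmin; rewrite ltnn.
exists k.+1; split=> //; first by rewrite exprS; lra.
have : k%:R * ln 2 <= ln x.
  rewrite mulr_natl -lnXn // ler_ln ?posrE ?exprn_gt0 //; [exact: ltW|lra].
have : k%:R * 2^-1 <= k%:R * ln 2 :> R by apply: ler_wpM2l => //; apply: ln2_ge.
rewrite -[k.+1%:R]natr1; lra.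
Qed.

(** Of the five logarithms, one comes from [e], one from [t <= 17 L], and three from [J <= 7 L]: the
    number of blocks, the accuracy and the failure probability required of each. *)
Lemma entropy_estimable (eps : R) : (0 < n)%N -> 0 < eps ->
  exists N : nat,
    N%:R <= 120 * 192 * 4 * 17 * 7 ^+ 3 * (Num.sqrt n%:R / eps) * ln (n%:R + eps^-1 + 2) ^+ 5 /\
    estimable q0 lab N (@shannon_entropy R n) eps (3^-1).
Proof.
move=> n0 eps0; have n1 : 1 <= n%:R :> R by rewrite ler1n.
have ie0 : 0 < eps^-1 by rewrite invr_gt0.
set z := n%:R + eps^-1 + 2; set L := ln z.
have sn0 : 0 <= Num.sqrt n%:R / eps by rewrite divr_ge0 ?sqrtr_ge0 ?(ltW eps0).
(* If [eps] is at least the maximal entropy, the answer 0 is accurate without a query. Otherwise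
   [eps < ln n], which bounds every parameter below in terms of [L]. *)
have [big|small] := leP (ln n%:R) eps.
  exists 0%N; split.
    apply: mulr_ge0; last by rewrite exprn_ge0 // ln_ge0 // /z; lra.
    by apply: mulr_ge0 sn0; rewrite mulr_ge0 ?exprn_ge0 // !mulr_ge0.
  apply: (estimable_weaken (N := 0) (err := 0)) => //; first by rewrite invr_ge0.
  apply: (@estimable_trivial R Q q0 n lab _ 0) => p pp.
  rewrite sub0r normrN ger0_norm ?entropy_ge0 //.
  exact: le_trans (entropy_le_ln n0 pp) big.
have n2 : (1 < n)%N.
  rewrite ltn_neqAle n0 andbT; apply/eqP => n1E.
  by move: small; rewrite -n1E ln1; lra.
have n2' : 2 <= n%:R :> R by rewrite (ler_nat _ 2 n).
have z4 : 4 <= z by rewrite /z; lra.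
have z0 : 0 < z by lra.
have Lz a b : 0 < a -> a <= z ^+ b -> ln a <= b%:R * L.
  by move=> a0 h; rewrite /L mulr_natl -lnXn // ler_ln ?posrE ?exprn_gt0.
have L1 : 1 <= L.
  have : ln 4 <= L by rewrite /L ler_ln ?posrE.
  have -> : ln 4 = 2 * ln 2 :> R.
    by rewrite mulr_natl -lnXn //; congr ln; rewrite expr2; ring.
  by have := ln2_ge; lra.
have Lle : L <= z by apply: ltW; apply: ln_sublinear.
have epsL : eps <= L.
  by apply: le_trans (ltW small) _; rewrite /L ler_ln ?posrE //; rewrite /z; lra.
have nz : n%:R <= z by rewrite /z; lra.
have ez : eps^-1 <= z by rewrite /z; lra.
pose x := 4 * n%:R / eps.
have x1 : 1 < x.
  rewrite /x ltr_pdivlMr // mul1r; apply: lt_le_trans small _.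
  by apply: le_trans (ltW (@ln_sublinear R n%:R _)) _; lra.
have [J [xJ Jx JL]] := pow2_ceil (ltW x1).
have J0 : (0 < J)%N by case: J xJ {Jx JL} => //; rewrite expr0; lra.
have J1 : 1 <= J%:R :> R by rewrite ler1n.
have J7 : J%:R <= 7 * L.
  have : ln x <= 3 * L.
    apply: Lz; first lra.
    rewrite /x exprS expr2 mulrA; apply: ler_pM => //; try lra.
    by apply: ler_pM => //; lra.
  lra.
(* The [J] block errors [2 e] add up to [eps / (2 L) <= eps / 2], and truncation takes at most
   [eps / 4]. The factor [L] ensures [e <= 1] although [eps] may be as large as [ln n]. *)
pose e := eps / (4 * J%:R * L).
have JL0 : 0 < 4 * J%:R * L by rewrite !mulr_gt0; lra.
have e0 : 0 < e by rewrite divr_gt0.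
have JL1 : 1 <= J%:R * L by nra.
have e1 : e <= 1 by rewrite ler_pdivrMr // mul1r; nra.
have eE : e^-1 = 4 * J%:R * L * eps^-1.
  by rewrite /e invf_div.
have e10 : 1 <= 10 / e.
  have : 1 <= e^-1 by rewrite invf_ge1. lra.
have [t [te _ tL]] := pow2_ceil e10.
have t17 : t%:R <= 17 * L.
  have : ln (10 / e) <= 8 * L.
    apply: Lz; first lra.
    have -> : 10 / e = (40 * J%:R) * (L * eps^-1) by rewrite eE; ring.
    have zz : 0 <= z by lra.
    have z6 : 40 * J%:R <= z ^+ 6.
      have h1 : 280 * z <= z ^+ 6.
        have h2 : 4 ^+ 5 <= z ^+ 5 by apply: lerXn2r; rewrite ?nnegrE.
        rewrite exprS mulrC; apply: ler_wpM2l => //; apply: le_trans h2.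
        by rewrite -natrX ler_nat.
      lra.
    have -> : z ^+ 8 = z ^+ 6 * (z * z) by ring.
    apply: ler_pM => //; first lra.
      by rewrite mulr_ge0 //; lra.
    by apply: ler_pM => //; lra.
  lra.
have blk j : (j < J)%N -> exists N : nat,
    N%:R <= 120 * 192 * t%:R * J%:R * (Num.sqrt n%:R / e) /\
    estimable q0 lab N (@entropy_block R n (2 ^ j)) (2 * e) (3 * J%:R)^-1.
  move=> jJ; apply: estimable_block_cost => //; first by rewrite e0.
  apply: le_trans (_ : x <= _).
    have : 2 * 2 ^+ j <= 2 * x.
      by rewrite -exprS; apply: le_trans Jx; rewrite ler_weXn2l //; lra.
    lra.
  have -> : n%:R / e = x * (J%:R * L) by rewrite /x eE; ring.
  by rewrite -[leLHS]mulr1; apply: ler_wpM2l => //; lra.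
pose Nf j := if pselect (j < J)%N is left h then projT1 (cid (blk j h)) else 0%N.
have NfE j : (j < J)%N -> (Nf j)%:R <= 120 * 192 * t%:R * J%:R * (Num.sqrt n%:R / e) /\
    estimable q0 lab (Nf j) (@entropy_block R n (2 ^ j)) (2 * e) (3 * J%:R)^-1.
  by move=> jJ; rewrite /Nf; case: pselect => // h; case: cid.
have S := estimable_sum (fun j jJ => (NfE j jJ).2).
exists (\sum_(j < J) Nf j)%N; split.
  have h (j : 'I_J) := (NfE j (ltn_ord j)).1.
  rewrite natr_sum; apply: le_trans (ler_sum _ (fun j _ => h j)) _.
  rewrite sumr_const card_ord -[leLHS]mulr_natr.
  have -> : Num.sqrt n%:R / e = 4 * J%:R * L * (Num.sqrt n%:R / eps) by rewrite eE; ring.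
  set s := Num.sqrt n%:R / eps in sn0 *.
  have -> : 120 * 192 * t%:R * J%:R * (4 * J%:R * L * s) * J%:R
    = 120 * 192 * 4 * s * L * (t%:R * J%:R ^+ 3) by ring.
  have -> : 120 * 192 * 4 * 17 * 7 ^+ 3 * s * L ^+ 5 = 120 * 192 * 4 * s * L * ((17 * L) * (7 * L) ^+ 3) by ring.
  have L0 : 0 <= L by lra.
  apply: ler_wpM2l; first by apply: mulr_ge0 L0; apply: mulr_ge0 sn0; rewrite !mulr_ge0.
  apply: ler_pM => //; first by rewrite exprn_ge0.
  by apply: lerXn2r; rewrite ?nnegrE //; lra.
have err : \sum_(j < J) (3 * J%:R)^-1 = 3^-1 :> R.
  by rewrite sumr_const card_ord -[LHS]mulr_natr; field; apply/eqP; lra.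
have acc : \sum_(j < J) 2 * e = eps / (2 * L).
  by rewrite sumr_const card_ord -[LHS]mulr_natr /e; field; rewrite !gt_eqF //; lra.
rewrite err acc in S.
have half : eps / (2 * L) <= eps / 2.
  by apply: ler_wpM2l; [exact: ltW|rewrite lef_pV2 ?posrE //; lra].
have -> : eps = eps / (2 * L) + (eps - eps / (2 * L)) by ring.
apply: estimable_shift S => p pp; apply: le_trans (entropy_truncation J pp) _.
have x0 : 0 < x by lra.
apply: le_trans (_ : n%:R / x <= _).
  by apply: ler_wpM2l => //; rewrite lef_pV2 ?posrE ?exprn_gt0.
have -> : n%:R / x = eps / 4 by rewrite /x; field; rewrite !gt_eqF //; lra.
lra.
Qed.

End Tuning.

(** * Compiling circuits to matrices *)

Section Compile.
Variable R : realType.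
Local Notation C := (R[i]).
Local Notation vec T := (T -> C).

Lemma uop_entry (V : finType) (U U' : vec V -> vec V) i j : uop U U' ->
  U (delta R j) i = conjc (U' (delta R i) j).
Proof.
move=> UU; rewrite -[LHS]dot_delta -[U' _ j]dot_delta dotC.
by have [-> _ _] := uopV UU.
Qed.

Section Coordinates.
Variables (D : nat) (V : finType) (toV : 'I_D -> V) (ofV : V -> 'I_D).
Hypotheses (toK : cancel toV ofV) (ofK : cancel ofV toV).

Definition col_of (v : vec V) : 'cV[C]_D := \col_i v (toV i).
Definition mx_of (U : vec V -> vec V) : 'M[C]_D :=
  \matrix_(i, j) U (delta R (toV j)) (toV i).

Lemma sumV (A : nmodType) (h : V -> A) : \sum_z h z = \sum_(j < D) h (toV j).
Proof. by rewrite (reindex toV) //; exists ofV => x _. Qed.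

Lemma mul_mx_of U U' v : uop U U' -> mx_of U *m col_of v = col_of (U v).
Proof.
move=> UU; apply/matrixP => i j; rewrite !mxE.
rewrite (uopE UU) /dot sumV; apply: eq_bigr => k _; rewrite !mxE; congr (_ * _).
exact: uop_entry.
Qed.

Lemma adjmx_of U U' : uop U U' -> adjmx (mx_of U) = mx_of U'.
Proof.
move=> UU; apply/matrixP => i j; rewrite !mxE.
by rewrite (uop_entry _ _ UU) conjcK.
Qed.

Lemma mx_ofV U U' : uop U U' -> mx_of U *m mx_of U' = 1%:M.
Proof.
move=> UU; apply/matrixP => i j; have := @mul_mx_of U U' (U' (delta R (toV j))) UU.
move/matrixP/(_ i 0); rewrite !mxE; have [_ _ ->] := UU.
rewrite /delta (can_eq toK) => <-; apply: eq_bigr => k _.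
by rewrite !mxE.
Qed.

Lemma unitary_mx_of U U' : uop U U' -> unitary (mx_of U).
Proof.
by move=> UU; rewrite /unitary (adjmx_of UU) (mx_ofV UU) (mx_ofV (uopV UU)).
Qed.

End Coordinates.

Lemma unitaryM D (A B : 'M[C]_D) : unitary A -> unitary B -> unitary (A *m B).
Proof.
move=> [a1 a2] [b1 b2]; have e : adjmx (A *m B) = adjmx B *m adjmx A.
  by rewrite /adjmx map_mxM trmx_mul.
split; rewrite e mulmxA.
  by rewrite -(mulmxA A) b1 mulmx1.
by rewrite -(mulmxA _ (adjmx A)) a2 mulmx1.
Qed.

Lemma unitary1 D : unitary (1%:M : 'M[C]_D).
Proof.
have e : adjmx (1%:M : 'M[C]_D) = 1%:M.
  by rewrite /adjmx map_mx1 trmx1.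
by split; rewrite e mulmx1.
Qed.

Variables (n m w : nat).
Local Notation Q := 'I_(n * m).
Variables (T : finType) (dec : 'I_w -> T) (enc : T -> 'I_w).
Hypotheses (decK : cancel dec enc) (encK : cancel enc dec).
Local Notation T' := ('I_2 * T)%type.
Local Notation D := (n * m * 2 * w)%N.

Definition to_reg (i : 'I_D) : Q * T' :=
  let ab := mxtens_unindex i in let qc := mxtens_unindex ab.1 in
  (qc.1, (qc.2, dec ab.2)).
Definition of_reg (z : Q * T') : 'I_D :=
  mxtens_index (mxtens_index (z.1, z.2.1), enc z.2.2).

Lemma to_regE q c b :
  to_reg (mxtens_index (mxtens_index (q, c), b)) = (q, (c, dec b)).
Proof.
rewrite /to_reg mxtens_indexK.
by rewrite -[(mxtens_index (q, c), b).1]/(mxtens_index (q, c)) mxtens_indexK.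
Qed.

Lemma to_regK : cancel to_reg of_reg.
Proof.
move=> i; case: (mxtens_indexP i) => a b; case: (mxtens_indexP a) => q c.
by rewrite to_regE /of_reg /= decK.
Qed.

Lemma of_regK : cancel of_reg to_reg.
Proof. by move=> [q [c t]]; rewrite /of_reg to_regE /= encK. Qed.

Lemma mul_tens1 (A : 'M[C]_(n * m)) (v : vec (Q * T')%type) :
  ((A *t (1%:M : 'M[C]_2)) *t (1%:M : 'M[C]_w)) *m col_of to_reg v
  = col_of to_reg (ask (mxop A) v).
Proof.
apply/matrixP => i j; rewrite mxE [RHS]mxE.
pose h z := (A *t (1%:M : 'M[C]_2) *t (1%:M : 'M[C]_w)) i (of_reg z) * v z.
rewrite (eq_bigr (fun k => h (to_reg k))); last first.
  by move=> k _; rewrite /h to_regK [col_of _ _ _ _]mxE.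
rewrite -(sumV to_regK of_regK h) /h -(to_regK i).
case: (to_reg i) => q [c t]; rewrite of_regK /ask /mxop /=.
pose F q' ct := (A *t (1%:M : 'M[C]_2) *t (1%:M : 'M[C]_w))
  (of_reg (q, (c, t))) (of_reg (q', ct)) * v (q', ct).
rewrite (eq_bigr (fun z => F z.1 z.2)); last by case.
rewrite -(pair_big xpredT xpredT F) /F /=.
apply: eq_bigr => q' _; rewrite (bigD1 (c, t)) //= big1 ?addr0; last first.
  move=> [c' t'] ct; rewrite /of_reg !tensmxE !mxE (can_eq encK) /=.
  move: ct; rewrite eq_sym xpair_eqE => /nandP[/negbTE|/negbTE] hct.
    by rewrite hct mulr0 !mul0r.
  by rewrite hct mulr0 mul0r.
by rewrite /of_reg !tensmxE !mxE !eqxx !mulr1.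
Qed.

(** Consecutive free gates are merged into the unitary after the preceding query, or into the
    initial one, so only queries create steps. *)
Fixpoint compile (gs : seq (gate R Q T')) : 'M[C]_D * seq (query_kind * 'M[C]_D) :=
  match gs with
  | [::] => (1%:M, [::])
  | Ask :: gs => (1%:M, (QO, (compile gs).1) :: (compile gs).2)
  | AskV :: gs => (1%:M, (QOadj, (compile gs).1) :: (compile gs).2)
  | Free U _ _ :: gs => ((compile gs).1 *m mx_of to_reg U, (compile gs).2)
  end.

Lemma size_compile gs : size (compile gs).2 = queries gs.
Proof. by elim: gs => //= -[||U U' UU] gs /= ->. Qed.

Lemma unitary_compile gs : unitary (compile gs).1 /\
  forall j, (j < size (compile gs).2)%N -> unitary (nth (QO, 1%:M) (compile gs).2 j).2.
Proof.
elim: gs => [|g gs [IH1 IH2]]; first by split=> //; apply: unitary1.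
case: g => [||U U' UU] /=.
- by split=> [|[|j]]; [apply: unitary1| |apply: IH2].
- by split=> [|[|j]]; [apply: unitary1| |apply: IH2].
- by split=> //; apply: unitaryM IH1 (unitary_mx_of to_regK of_regK UU).
Qed.

Lemma final_compile (O : 'M[C]_(n * m)) gs v :
  foldl (fun st kU => kU.2 *m (query_op O kU.1 *m st))
    ((compile gs).1 *m col_of to_reg v) (compile gs).2
  = col_of to_reg (run (mxop O) (mxop (adjmx O)) gs v).
Proof.
elim: gs v => [|g gs IH] v /=; first by rewrite mul1mx.
case: g => [||U U' UU] /=.
- by rewrite mul1mx mul_tens1 IH.
- by rewrite mul1mx mul_tens1 IH.
- by rewrite -mulmxA (mul_mx_of to_regK of_regK _ UU) IH.
Qed.

End Compile.

(** * Probability oracles as samplers and the resulting algorithm *)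

Section OracleSamples.
Variable R : realType.
Local Notation C := (R[i]).

(** For a fixed label [i], summing over the garbage register gives the squared norm of [psi i],
    which is 1, so [p i] remains. *)
Lemma prob_oracle_samples n m (p : 'I_n -> R) (O : 'M[C]_(n * m)) (q0 : 'I_(n * m)) :
  val q0 = 0%N -> prob_dist p -> prob_oracle p O ->
  samples q0 (fun q => (mxtens_unindex q).1) p (mxop O) (mxop (adjmx O)).
Proof.
move=> q00 [p0 _] [Ou [psi [orth OE]]]; split; first exact: uop_mxop.
have E q : mxop O (delta R q0) q = (Num.sqrt (p (mxtens_unindex q).1))%:C%C *
    psi (mxtens_unindex q).1 (mxtens_unindex q).2 0.
  have -> : mxop O (delta R q0) q = (O *m ket0 R) q 0.
    rewrite mxE; apply: eq_bigr => k _; rewrite mxE; congr (_ * _).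
    by rewrite /delta -val_eqE /= q00.
  rewrite OE summxE (bigD1 (mxtens_unindex q).1) //= big1 ?addr0.
    by rewrite !mxE eqxx mul1r; congr (_ * psi _ _ _); apply: val_inj.
  by move=> i /negbTE h; rewrite !mxE eq_sym h mul0r mulr0.
move=> i; rewrite (reindex (@mxtens_index n m)); last first.
  by exists (@mxtens_unindex n m) => x _; rewrite ?mxtens_indexK ?mxtens_unindexK.
pose F a b := sqmod (mxop O (delta R q0) (mxtens_index (a, b))).
rewrite (eq_big (fun x => (x.1 == i) && xpredT x.2) (fun x => F x.1 x.2)); first last.
- by case.
- by move=> x; rewrite mxtens_indexK andbT.
rewrite -(pair_big (pred1 i) xpredT F) /= big_pred1_eq /F.
rewrite (eq_bigr (fun b => p i * sqmod (psi i b 0))).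
  rewrite -mulr_sumr; have /matrixP/(_ 0 0) := orth i i.
  rewrite !mxE eqxx !mulr1n => h.
  have -> : \sum_(b < m) sqmod (psi i b 0) = 1; last by rewrite mulr1.
  apply: (@complexI R); rewrite rmorph_sum [RHS]rmorph1 -h; apply: eq_bigr => b _.
  by rewrite /= sqmodE !mxE.
by move=> b _; rewrite E mxtens_indexK /= sqmodM sqmodR sqr_sqrtr.
Qed.

End OracleSamples.

Section Algorithm.
Variable R : realType.
Local Notation C := (R[i]).

(** The model starts in [ket0], so the enumeration is corrected by a transposition that gives [t0]
    the index 0. *)
Lemma enum_at (T : finType) (t0 : T) : exists (dec : 'I_#|T| -> T) (enc : T -> 'I_#|T|),
  [/\ cancel dec enc, cancel enc dec & val (enc t0) = 0%N].
Proof.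
have T0 : (0 < #|T|)%N by apply/card_gt0P; exists t0.
pose i0 : 'I_#|T| := Ordinal T0; pose s := tperm i0 (enum_rank t0).
exists (fun i => enum_val (s i)), (fun t => s (enum_rank t)); split.
- by move=> i; rewrite enum_valK /s tpermK.
- by move=> t; rewrite /s tpermK enum_rankK.
- by rewrite /s tpermR.
Qed.

Lemma estimable_algorithm n m (q0 : 'I_(n * m)) (N : nat)
    (tau : ('I_n -> R) -> R) (e err : R) : val q0 = 0%N ->
  estimable q0 (fun q => (mxtens_unindex q).1) N tau e err ->
  exists (w : nat) (U0 : 'M[C]_(n * m * 2 * w))
         (steps : seq (query_kind * 'M[C]_(n * m * 2 * w)))
         (f : 'I_(n * m * 2 * w) -> R),
    (size steps <= N)%N /\ unitary U0 /\
    (forall j, (j < size steps)%N -> unitary (nth (QO, 1%:M) steps j).2) /\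
    forall (p : 'I_n -> R), prob_dist p ->
    forall (O : 'M[C]_(n * m)), prob_oracle p O ->
      1 - err <= success_prob (final_state O U0 steps) f (tau p) e.
Proof.
move=> q00 [T [t0 [gs [f [qs h]]]]].
have [dec [enc [decK encK enc0]]] := enum_at t0.
pose T' := ('I_2 * T)%type.
pose F (x : T') : T * 'I_2 := (x.2, x.1); pose G (y : T * 'I_2) : T' := (y.2, y.1).
have FK : cancel F G by case.
have GK : cancel G F by case.
pose hs := map (lift_gate FK GK) gs.
pose toV := @to_reg n m _ T dec.
have tK : cancel toV (of_reg enc) := to_regK decK.
have oK : cancel (of_reg enc) toV := of_regK encK.
have [c1 c2] := unitary_compile decK encK hs.
exists #|T|, (compile dec hs).1, (compile dec hs).2, (fun i => f ((toV i).1, (toV i).2.2)).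
split.
  by rewrite size_compile /queries count_map; apply: leq_trans qs; apply: eq_leq; apply: eq_count => -[].
split=> //; split=> // p pp O pO.
have so := prob_oracle_samples q00 pp pO; have [oo' _] := so.
set run' := run (mxop O) (mxop (adjmx O)).
pose ini : 'I_(n * m) * T' -> C := delta R (q0, (ord0, t0)).
have k0 : ket0 R = col_of toV ini.
  apply/matrixP => i j; rewrite !mxE /ini /delta; congr (_%:R); congr nat_of_bool.
  rewrite -(can_eq oK) tK -val_eqE /=.
  by rewrite q00 enc0 !mul0n.
have st : final_state O (compile dec hs).1 (compile dec hs).2 = col_of toV (run' _ hs ini).
  by rewrite /final_state k0; apply: final_compile.
rewrite st /success_prob.
pose P (z : 'I_(n * m) * T') := `|f (z.1, z.2.2) - tau p| <= e.
pose S z := sqmod (run' _ hs ini z).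
have -> : \sum_(j | `|f ((toV j).1, (toV j).2.2) - tau p| <= e)
    sqmod (col_of toV (run' _ hs ini) j 0) = \sum_(z | P z) S z.
  rewrite [RHS](reindex toV); last by exists (of_reg enc) => x _.
  by apply: eq_bigr => j _; rewrite mxE.
have tot : \sum_z S z = 1.
  by rewrite -/(nrm2 _) (uop_nrm2 (uop_run oo' hs)) delta_nrm2.
have iniE c z : S (lift_from G (z, c)) = sqmod ((c == ord0)%:R *
    run' _ gs (delta R (q0, t0)) z).
  rewrite /S -[run' _ hs ini _]/(slice (lift_from G) c (run' _ hs ini) z) run_lift.
  rewrite (_ : slice _ _ _ = fun z => (c == ord0)%:R * delta R (q0, t0) z).
    by rewrite (uop_scale _ _ (uop_run oo' gs)).
  apply: funext => -[q t]; rewrite /slice /lift_from /ini /delta -!pair_eqE /= ?xpair_eqE.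
  by case: (q == q0); case: (c == ord0); case: (t == t0); rewrite /= ?(mulr0, mulr1).
have bad : \sum_(z | ~~ P z) S z <= err.
  apply: le_trans (h p pp _ _ so).
  rewrite big_mkcond /= (sum_slice (lift_toK FK) (lift_fromK GK)) (bigD1 ord0) //=.
  rewrite [X in _ + X]big1 ?addr0; last first.
    move=> c c0; apply: big1 => z _; rewrite iniE (negbTE c0) /=.
    by rewrite mul0r /= expr0n addr0 if_same.
  rewrite [leRHS]big_mkcond; apply: ler_sum => -[q t] _.
  by rewrite iniE eqxx mul1r /P /= -ltNge.
by rewrite lerBlDr -tot (bigID P) /= lerD2l.
Qed.

End Algorithm.

(* There are constants c, k such that for every n >= 1, eps > 0 and every
   garbage-register dimension m >= 1, there is a quantum query algorithm
   using at most c * sqrt(n)/eps * (ln (n + 1/eps + 2))^k queries (i.e.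
   O~(sqrt n / eps)) which, for every probability distribution p on n points
   and every probability oracle O_p for p, outputs (after a computational
   basis measurement and classical post-processing f) an estimate of H(p)
   within additive error eps with probability at least 2/3. *)
Theorem theorem5 (R : realType) :
  exists (c : R) (k : nat),
  forall (n : nat) (eps : R), (0 < n)%N -> 0 < eps ->
  forall (m : nat), (0 < m)%N ->
  exists (w : nat) (U0 : 'M[R[i]]_(n * m * 2 * w))
         (steps : seq (query_kind * 'M[R[i]]_(n * m * 2 * w)))
         (f : 'I_(n * m * 2 * w) -> R),
    (size steps)%:R <= c * (Num.sqrt n%:R / eps) * (ln (n%:R + eps^-1 + 2)) ^+ k /\
    unitary U0 /\ (forall j, (j < size steps)%N -> unitary (nth (QO, 1%:M) steps j).2) /\
    forall (p : 'I_n -> R), prob_dist p ->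
    forall (O : 'M[R[i]]_(n * m)), prob_oracle p O ->
      2 / 3 <= success_prob (final_state O U0 steps) f (shannon_entropy p) eps.
Proof.
exists (120 * 192 * 4 * 17 * 7 ^+ 3), 5%N => n eps n0 eps0 m m0.
have nm0 : (0 < n * m)%N by rewrite muln_gt0 n0.
pose q0 : 'I_(n * m) := Ordinal nm0.
have [N [Nle est]] := entropy_estimable q0 (fun q => (mxtens_unindex q).1) n0 eps0.
have [w [U0 [steps [f [sN [hU [hs hp]]]]]]] := estimable_algorithm (erefl : val q0 = 0%N) est.
exists w, U0, steps, f; split.
  by apply: le_trans Nle; rewrite ler_nat.
split=> //; split=> // p pp O pO.
have := hp p pp O pO; lra.
Qed.
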